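(* Let $\mathbf{g}\in\mathbb{R}^d$ have non-zero entries, let $\epsilon>0$, and let $\mathsf{RN}:\mathbb{R}^d\to\mathbb{R}^d$, $\mathsf{RN}(\mathbf{x})=\dfrac{\mathbf{g}\odot\mathbf{x}}{\sqrt{\|\mathbf{x}\|_2^2+\epsilon}}$. Let $\mathbf{x}\in\mathbb{R}^d$. The normwise condition numbers of $\mathsf{RN}$ satisfy $$\kappa_{2,2}(\mathsf{RN},\mathbf{x})\le\frac{\|\mathbf{g}\|_\infty\|\mathbf{x}\|_2}{\|\mathbf{g}\odot\mathbf{x}\|_2},$$ $$\kappa_{2,\infty}(\mathsf{RN},\mathbf{x})=\max_{1\le i\le d}|g_i|\sqrt{1-\Big(1+\frac{\epsilon}{\|\mathbf{x}\|_2^2+\epsilon}\Big)\frac{x_i^2}{\|\mathbf{x}\|_2^2+\epsilon}}\;\frac{\|\mathbf{x}\|_2}{\|\mathbf{g}\odot\mathbf{x}\|_\infty},$$ $$\kappa_{\infty,2}(\mathsf{RN},\mathbf{x})\le\max_{\mathbf{v}\in\{-1,1\}^d}\sqrt{d-\Big(1+\frac{\epsilon}{\|\mathbf{x}\|_2^2+\epsilon}\Big)\frac{(\mathbf{v}^\top\mathbf{x})^2}{\|\mathbf{x}\|_2^2+\epsilon}}\;\frac{\|\mathbf{g}\|_\infty\|\mathbf{x}\|_\infty}{\|\mathbf{g}\odot\mathbf{x}\|_2},$$ $$\kappa_{\infty,\infty}(\mathsf{RN},\mathbf{x})=\max_{1\le i\le d}|g_i|\Big(1+\frac{|x_i|(\|\mathbf{x}\|_1-2|x_i|)}{\|\mathbf{x}\|_2^2+\epsilon}\Big)\frac{\|\mathbf{x}\|_\infty}{\|\mathbf{g}\odot\mathbf{x}\|_\infty},$$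 its mixed condition numbers satisfy $$\kappa_{c,\infty}(\mathsf{RN},\mathbf{x})=2\max_{1\le i\le d}|g_ix_i|\Big(1-\frac{x_i^2+\epsilon/2}{\|\mathbf{x}\|_2^2+\epsilon}\Big)\frac{1}{\|\mathbf{g}\odot\mathbf{x}\|_\infty},$$ $$\kappa_{\infty,c}(\mathsf{RN},\mathbf{x})=\Big(\frac{1}{\|\mathbf{x}\|_{-\infty}}+\frac{\|\mathbf{x}\|_1-2\|\mathbf{x}\|_{-\infty}}{\|\mathbf{x}\|_2^2+\epsilon}\Big)\|\mathbf{x}\|_\infty,$$ $$\kappa_{c,2}(\mathsf{RN},\mathbf{x})\le\max_{\mathbf{v}\in\{-1,1\}^d}\sqrt{\|\mathbf{x}\|_2^2-\Big(1+\frac{\epsilon}{\|\mathbf{x}\|_2^2+\epsilon}\Big)\frac{(\mathbf{v}^\top(\mathbf{x}\odot\mathbf{x}))^2}{\|\mathbf{x}\|_2^2+\epsilon}}\;\frac{\|\mathbf{g}\|_\infty}{\|\mathbf{g}\odot\mathbf{x}\|_2},$$ $$\kappa_{2,c}(\mathsf{RN},\mathbf{x})=\sqrt{\frac{1}{\|\mathbf{x}\|_{-\infty}^2}-\Big(1+\frac{\epsilon}{\|\mathbf{x}\|_2^2+\epsilon}\Big)\frac{1}{\|\mathbf{x}\|_2^2+\epsilon}}\;\|\mathbf{x}\|_2,$$ and its componentwise condition number equals $$\kappa_{c,c}(\mathsf{RN},\mathbf{x})=2\Big(1-\frac{\|\mathbf{x}\|_{-\infty}^2+\epsilon/2}{\|\mathbf{x}\|_2^2+\epsilon}\Big).$$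 The inequalities become equalities when $\mathbf{g}=g\mathbf{1}$ for a scalar $g$.
   Context: $\odot$ is the entrywise (Hadamard) product, $\mathbf{1}$ the all-ones vector, $\|\mathbf{x}\|_{-\infty}=\min_i|x_i|$. Condition numbers: for vectors $\hat{\mathbf w},\mathbf w$ put $\rho_p(\hat{\mathbf w},\mathbf w)=\|\hat{\mathbf w}-\mathbf w\|_p/\|\mathbf w\|_p$ ($1\le p\le\infty$) and $\rho_c(\hat{\mathbf w},\mathbf w)=\max_i|(\hat w_i-w_i)/w_i|$, with the conventions $a/0=\infty$ for $a\ne0$ and $0/0=0$. For a function $f$ between Euclidean spaces, a point $\mathbf v$, and $\theta_{in},\theta_{out}\in[1,\infty]\cup\{c\}$, $$\kappa_{\theta_{in},\theta_{out}}(f,\mathbf v)=\lim_{t\to0}\sup\Big\{\frac{\rho_{\theta_{out}}(f(\hat{\mathbf v}),f(\mathbf v))}{\rho_{\theta_{in}}(\hat{\mathbf v},\mathbf v)}:\rho_{\theta_{in}}(\hat{\mathbf v},\mathbf v)\le t\Big\},$$ where $\hat{\mathbf v}=\mathbf v$ is allowed. Condition numbers may be infinite.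
   Formalization: The κ_{c,c} formula is stated only for x with all entries nonzero (it fails if some x_i = 0, e.g. x = (1,0)), and equality in the κ_{2,2} bound for g = g1 only for d ≥ 2 or x = 0 (for d = 1, x ≠ 0 the true value is ε/(x²+ε) < 1). *)

(* Defs.v *)
From mathcomp Require Export all_boot all_order all_algebra.
From mathcomp Require Export all_classical all_reals all_analysis.

Set Implicit Arguments.
Unset Strict Implicit.
Unset Printing Implicit Defensive.

Export Order.TTheory GRing.Theory Num.Theory.
Export numFieldNormedType.Exports.

Local Open Scope classical_set_scope.
Local Open Scope ring_scope.

(* Vectors of R^d are row vectors x : 'rV[R]_d with entries x 0 i. *)

(* The norm `|x| of a row vector in MathComp-Analysis is max_i |x_i|.
   The exponent -oo gives ||x||_{-oo} = min_i |x_i|; the default value of that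
   minimum bounds every |x_i|, so it is neutral as soon as 0 < d. *)
Definition lpnorm (R : realType) (d : nat) (p : \bar R) (x : 'rV[R]_d) : R :=
  match p with
  | r%:E => (\sum_(i < d) `|x 0 i| `^ r) `^ r^-1
  | +oo%E => `|x|
  | -oo%E => \big[Num.min/`|x|]_(i < d) `|x 0 i|
  end.

Notation norm1 := (lpnorm 1%:E).
Notation norm2 := (lpnorm 2%:E).
Notation normoo := (lpnorm +oo%E).
Notation normNoo := (lpnorm -oo%E).

Definition hadamard (R : realType) (d : nat) (x y : 'rV[R]_d) : 'rV[R]_d :=
  \row_i (x 0 i * y 0 i).

Definition dotp (R : realType) (d : nat) (x y : 'rV[R]_d) : R :=
  \sum_(i < d) x 0 i * y 0 i.

(* As s ranges over the boolean functions, signs R s ranges over {-1, 1}^d. *)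
Definition signs (R : realType) (d : nat) (s : {ffun 'I_d -> bool}) : 'rV[R]_d :=
  \row_i (-1) ^+ s i.

Arguments signs R {d} s.

(* The indices theta in [1, oo] U {c}; Lp p is meant for 1 <= p. *)
Variant metric (R : realType) : Type :=
  | Lp of \bar R
  | Componentwise.

Arguments Componentwise {R}.

(* In \bar R, 0^-1 = +oo and 0 * +oo = 0, so that the quotients below satisfy
   |a / 0| = +oo for a != 0 and 0 / 0 = 0. *)
Definition rho (R : realType) (d : nat) (theta : metric R) (wh w : 'rV[R]_d)
    : \bar R :=
  match theta with
  | Lp p => ((lpnorm p (wh - w))%:E / (lpnorm p w)%:E)%E
  | Componentwise =>
      \big[maxe/0%E]_(i < d) `|(wh 0 i - w 0 i)%:E / (w 0 i)%:E|%E
  end.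

Definition kappa (R : realType) (m n : nat) (theta_in theta_out : metric R)
    (f : 'rV[R]_m -> 'rV[R]_n) (v : 'rV[R]_m) : \bar R :=
  lim (ereal_sup [set (rho theta_out (f vh) (f v) / rho theta_in vh v)%E
                 | vh in [set vh | (rho theta_in vh v <= t%:E)%E]]
       @[t --> 0^'+]).

Definition RN (R : realType) (d : nat) (g : 'rV[R]_d) (eps : R)
    (x : 'rV[R]_d) : 'rV[R]_d :=
  (Num.sqrt (norm2 x ^+ 2 + eps))^-1 *: hadamard g x.

(* Main.v *)
(* For x = 0 the only admissible perturbation is 0 and every condition number
   vanishes. Otherwise RN is differentiable at x and, up to a scalar which
   cancels in rho, its differential is h |-> g o J h with
   J = I - x x^T / (|x|_2^2 + eps) symmetric. A condition number is then the
   operator norm of this map between two weighted norms. When the output norm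
   is a weighted maximum of entries, it is the largest weighted dual norm of a
   row of J. When it is the 2-norm, |g o J h|_2 <= |g|_oo |J h|_2, with equality
   if g is constant, and the maximum of |J h|_2 over a box is reached at a
   vertex. When the output is measured componentwise and some x_i = 0, moving
   x_i alone makes rho infinite. *)
Require Import Defs.
From mathcomp Require Import ring lra.

Set Implicit Arguments.
Unset Strict Implicit.
Unset Printing Implicit Defensive.

Local Open Scope classical_set_scope.
Local Open Scope ring_scope.

(** * Scalar product and norms *)

(** The obstacle is that [rho] and the quotients live in [\bar R], where zero denominators give 0 or
    [+oo]. They are therefore reduced once to the real-valued [rnorm] and the test [supported]; the
    points where this reduction breaks down ([x = 0], or a zero output entry measured componentwise)
    are treated apart. Since every [rnorm] is comparable with [snorm], a single differentiability
    estimate in [snorm] serves all nine pairs of metrics. An upper bound on a condition number then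
    asks for an inequality valid for all [h], and a lower bound for one extremal direction.

    The two restricted claims come from the same picture. For [d = 1] and [x != 0], [J] is the
    scalar [eps / S < 1], with [S] the squared 2-norm of [x] plus [eps], so no direction is left
    fixed by [J] and the 2,2 bound is strict. When some [x_i = 0], a componentwise perturbation
    cannot move that entry, so the true minimum runs over the nonzero entries only. *)

Lemma dotpE (R : realType) d (x y : 'rV[R]_d) :
  dotp x y = \sum_i x 0 i * y 0 i.
Proof. by []. Qed.

Lemma dotpC (R : realType) d (x y : 'rV[R]_d) : dotp x y = dotp y x.
Proof. by apply: eq_bigr => i _; rewrite mulrC. Qed.

Lemma dotpDr (R : realType) d (x y z : 'rV[R]_d) :
  dotp x (y + z) = dotp x y + dotp x z.
Proof. by rewrite -big_split; apply: eq_bigr => i _; rewrite mxE mulrDr. Qed.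

Lemma dotpZr (R : realType) d a (x y : 'rV[R]_d) :
  dotp x (a *: y) = a * dotp x y.
Proof. by rewrite mulr_sumr; apply: eq_bigr => i _; rewrite mxE mulrCA. Qed.

Lemma dotpNr (R : realType) d (x y : 'rV[R]_d) : dotp x (- y) = - dotp x y.
Proof. by rewrite -scaleN1r dotpZr mulN1r. Qed.

Lemma dotpBr (R : realType) d (x y z : 'rV[R]_d) :
  dotp x (y - z) = dotp x y - dotp x z.
Proof. by rewrite dotpDr dotpNr. Qed.

Lemma dotpBl (R : realType) d (x y z : 'rV[R]_d) :
  dotp (x - y) z = dotp x z - dotp y z.
Proof. by rewrite !(dotpC _ z) dotpBr. Qed.

Lemma dotpZl (R : realType) d a (x y : 'rV[R]_d) :
  dotp (a *: x) y = a * dotp x y.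
Proof. by rewrite dotpC dotpZr dotpC. Qed.

Lemma dotpDl (R : realType) d (x y z : 'rV[R]_d) :
  dotp (x + y) z = dotp x z + dotp y z.
Proof. by rewrite !(dotpC _ z) dotpDr. Qed.

Lemma dotp_deltal (R : realType) d (i : 'I_d) (x : 'rV[R]_d) :
  dotp (delta_mx 0 i) x = x 0 i.
Proof.
rewrite /dotp (bigD1 i) //= mxE !eqxx mul1r big1 ?addr0 // => j /negPf ji.
by rewrite mxE ji andbF mul0r.
Qed.

Lemma dotp_ge0 (R : realType) d (x : 'rV[R]_d) : 0 <= dotp x x.
Proof. by apply: sumr_ge0 => i _; rewrite -expr2 sqr_ge0. Qed.

Lemma dotp_eq0 (R : realType) d (x : 'rV[R]_d) : (dotp x x == 0) = (x == 0).
Proof.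
apply/eqP/eqP => [|->]; last by rewrite /dotp big1 // => i _; rewrite mxE mul0r.
move/psumr_eq0P => h; apply/rowP => i; rewrite mxE; apply/eqP.
have /eqP := h (fun j _ => sqr_ge0 (x 0 j)) i isT.
by rewrite mulf_eq0 orbb.
Qed.

Lemma dotp_gt0 (R : realType) d (x : 'rV[R]_d) : (0 < dotp x x) = (x != 0).
Proof. by rewrite lt_def dotp_ge0 andbT dotp_eq0. Qed.

Definition enorm (R : realType) (d : nat) (x : 'rV[R]_d) : R :=
  Num.sqrt (dotp x x).

Lemma norm2E (R : realType) d : lpnorm 2%:E = @enorm R d.
Proof.
apply/funext => x; rewrite /= powR12_sqrt; last first.
  by apply: sumr_ge0 => i _; rewrite powR_ge0.
by congr Num.sqrt; apply: eq_bigr => i _; rewrite powR_mulrn // -normrX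
  ger0_norm ?sqr_ge0 // expr2.
Qed.

Definition snorm (R : realType) (d : nat) (x : 'rV[R]_d) : R :=
  \big[Num.max/0]_i `|x 0 i|.

Lemma normooE (R : realType) d : lpnorm +oo%E = @snorm R d.
Proof.
apply/funext => x; rewrite /= [LHS]mx_normrE; apply/le_anti/andP; split.
  apply: bigmax_le => [|[j i] _ /=]; first exact: bigmax_ge_id.
  by rewrite (ord1 j); exact: le_bigmax.
apply: bigmax_le => [|i _]; first exact: bigmax_ge_id.
exact: (le_bigmax _ (fun ij => `|x ij.1 ij.2|) (0, i)).
Qed.

Lemma norm1E (R : realType) d (x : 'rV[R]_d) : norm1 x = \sum_i `|x 0 i|.
Proof.
rewrite /= invr1 powRr1; last by apply: sumr_ge0 => i _; rewrite powR_ge0.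
by apply: eq_bigr => i _; rewrite powRr1.
Qed.

Lemma snorm_ge0 (R : realType) d (x : 'rV[R]_d) : 0 <= snorm x.
Proof. exact: bigmax_ge_id. Qed.

Lemma hadamardE (R : realType) d (x y : 'rV[R]_d) i :
  hadamard x y 0 i = x 0 i * y 0 i.
Proof. by rewrite mxE. Qed.

Lemma enorm_sqr (R : realType) d (x : 'rV[R]_d) : enorm x ^+ 2 = dotp x x.
Proof. by rewrite /enorm sqr_sqrtr // dotp_ge0. Qed.

Lemma enorm_ge0 (R : realType) d (x : 'rV[R]_d) : 0 <= enorm x.
Proof. by rewrite /enorm sqrtr_ge0. Qed.

Lemma enorm_eq0 (R : realType) d (x : 'rV[R]_d) : (enorm x == 0) = (x == 0).
Proof. by rewrite /enorm sqrtr_eq0 -dotp_eq0 eq_le dotp_ge0 andbT. Qed.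

Lemma enorm_gt0 (R : realType) d (x : 'rV[R]_d) : (0 < enorm x) = (x != 0).
Proof. by rewrite lt_def enorm_ge0 andbT enorm_eq0. Qed.

Lemma enormZ (R : realType) d a (x : 'rV[R]_d) :
  enorm (a *: x) = `|a| * enorm x.
Proof.
by rewrite /enorm dotpZr dotpZl mulrA -expr2 sqrtrM ?sqr_ge0 // sqrtr_sqr.
Qed.

Lemma cauchy_schwarz (R : realType) d (x y : 'rV[R]_d) :
  `|dotp x y| <= enorm x * enorm y.
Proof.
suff h : dotp x y ^+ 2 <= dotp x x * dotp y y.
  by rewrite /enorm -sqrtrM ?dotp_ge0 // -sqrtr_sqr ler_wsqrtr.
have [->|y0] := eqVneq y 0.
  have -> : dotp x 0 = 0 by rewrite -[0](scale0r x) dotpZr mul0r.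
  by rewrite expr0n mulr_ge0 ?dotp_ge0.
(* This vector is the component of [x] orthogonal to [y], scaled by [dotp y y] to avoid a
   division. *)
have := dotp_ge0 (dotp y y *: x - dotp x y *: y).
rewrite !(dotpBl, dotpBr, dotpZl, dotpZr) (dotpC y x).
set a := dotp x x; set b := dotp y y; set c := dotp x y.
have b0 : 0 < b by rewrite dotp_gt0.
rewrite [X in 0 <= X](_ : _ = b * (a * b - c ^+ 2)); last by ring.
by rewrite pmulr_rge0 // subr_ge0.
Qed.

Lemma ler_enormD (R : realType) d (x y : 'rV[R]_d) :
  enorm (x + y) <= enorm x + enorm y.
Proof.
rewrite -(@ler_pXn2r _ 2) ?nnegrE ?addr_ge0 ?enorm_ge0 // sqrrD.
have -> : enorm (x + y) ^+ 2 = enorm x ^+ 2 + dotp x y *+ 2 + enorm y ^+ 2.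
  rewrite !enorm_sqr dotpDl dotpDr [dotp y (x + y)]dotpDr (dotpC y x).
  by rewrite mulr2n !addrA.
rewrite lerD2r lerD2l lerMn2r /=.
exact: le_trans (ler_norm _) (cauchy_schwarz x y).
Qed.

Lemma ler_entry_snorm (R : realType) d (x : 'rV[R]_d) i :
  `|x 0 i| <= snorm x.
Proof. exact: le_bigmax. Qed.

Lemma ler_entry_enorm (R : realType) d (x : 'rV[R]_d) i : `|x 0 i| <= enorm x.
Proof.
rewrite /enorm -sqrtr_sqr ler_wsqrtr // dotpE (bigD1 i) //= -expr2 lerDl.
by apply: sumr_ge0 => j _; rewrite -expr2 sqr_ge0.
Qed.

Lemma snorm_le_enorm (R : realType) d (x : 'rV[R]_d) : snorm x <= enorm x.
Proof.
apply: bigmax_le => [|i _]; first exact: enorm_ge0.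
exact: ler_entry_enorm.
Qed.

Lemma enorm_le_snorm (R : realType) d (x : 'rV[R]_d) :
  enorm x <= Num.sqrt d%:R * snorm x.
Proof.
rewrite /enorm dotpE -[X in _ * X]ger0_norm ?snorm_ge0 // -sqrtr_sqr.
rewrite -sqrtrM ?ler0n //.
apply: ler_wsqrtr; rewrite mulr_natl -[X in _ *+ X](card_ord d) -sumr_const.
apply: ler_sum => i _; rewrite -expr2 -(real_normK (num_real (x 0 i))).
by apply: lerXn2r; rewrite ?nnegrE ?normr_ge0 ?snorm_ge0 ?ler_entry_snorm.
Qed.

Lemma hadamard_eq0 (R : realType) d (g x : 'rV[R]_d) :
  (forall i, g 0 i != 0) -> (hadamard g x == 0) = (x == 0).
Proof.
move=> g0; apply/eqP/eqP => [/rowP h|->]; apply/rowP => i; last first.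
  by rewrite hadamardE mxE mulr0.
have /eqP := h i; rewrite hadamardE !mxE mulf_eq0 (negPf (g0 i)) /=.
exact: eqP.
Qed.

Lemma enorm_hadamard (R : realType) d (g x : 'rV[R]_d) :
  enorm (hadamard g x) <= snorm g * enorm x.
Proof.
rewrite -(@ler_pXn2r _ 2) ?nnegrE ?mulr_ge0 ?enorm_ge0 ?snorm_ge0 //.
rewrite exprMn !enorm_sqr.
rewrite !dotpE mulr_sumr; apply: ler_sum => i _.
rewrite !hadamardE mulrACA -!expr2 ler_wpM2r ?sqr_ge0 //.
rewrite -(real_normK (num_real (g 0 i))) ler_pXn2r ?nnegrE ?snorm_ge0 //.
exact: ler_entry_snorm.
Qed.

Lemma snorm_eq0 (R : realType) d (x : 'rV[R]_d) : (snorm x == 0) = (x == 0).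
Proof.
apply/eqP/eqP => [h|->]; last first.
  by apply: bigmax_eq_id => i _; rewrite mxE normr0.
apply/rowP => i; apply/eqP; rewrite mxE -normr_eq0 eq_le normr_ge0 andbT -h.
exact: ler_entry_snorm.
Qed.

Lemma snorm_gt0 (R : realType) d (x : 'rV[R]_d) : (0 < snorm x) = (x != 0).
Proof. by rewrite lt_def snorm_ge0 andbT snorm_eq0. Qed.

Lemma snorm_le (R : realType) d (x : 'rV[R]_d) (M : R) :
  0 <= M -> (forall i, `|x 0 i| <= M) -> snorm x <= M.
Proof. by move=> M0 h; apply: bigmax_le => // i _; exact: h. Qed.

Lemma bigmaxZ (R : realType) (I : finType) (F : I -> R) a :
  0 <= a -> \big[Num.max/0]_i (a * F i) = a * \big[Num.max/0]_i F i.
Proof.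
move=> a0.
exact/esym/(big_morph ( *%R a) (fun y z => maxr_pMr y z a0) (mulr0 a)).
Qed.

Lemma snormZ (R : realType) d a (x : 'rV[R]_d) :
  snorm (a *: x) = `|a| * snorm x.
Proof.
by rewrite -bigmaxZ //; apply: eq_bigr => i _; rewrite mxE normrM.
Qed.

Lemma ler_snormD (R : realType) d (x y : 'rV[R]_d) :
  snorm (x + y) <= snorm x + snorm y.
Proof.
apply: snorm_le => [|i]; first by rewrite addr_ge0 ?snorm_ge0.
rewrite mxE; apply: le_trans (ler_normD _ _) _.
by rewrite lerD ?ler_entry_snorm.
Qed.

(** * Condition numbers from a linear approximation *)

Variant theta : Type := Two | Infty | Comp.

Definition metric_of (R : realType) (th : theta) : metric R :=
  match th with
  | Two => Lp 2%:E
  | Infty => Lp +oo%E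
  | Comp => Componentwise
  end.

(* rho theta (y + h) y is rnorm theta y h when h is supported, and +oo
   otherwise; x / 0 = 0 in R makes the entries with y_i = h_i = 0 harmless. *)
Definition rnorm (R : realType) d (th : theta) (y h : 'rV[R]_d) : R :=
  match th with
  | Two => enorm h / enorm y
  | Infty => snorm h / snorm y
  | Comp => \big[Num.max/0]_i `|h 0 i / y 0 i|
  end.

Definition supported (R : realType) d (th : theta) (y h : 'rV[R]_d) : bool :=
  if th is Comp then [forall i, (y 0 i == 0) ==> (h 0 i == 0)] else true.

Lemma divEFin (R : realType) (a b : R) :
  b != 0 -> (a%:E / b%:E = (a / b)%:E)%E.
Proof. by move=> b0; rewrite inver (negPf b0). Qed.

Lemma rhoE (R : realType) d th (w y : 'rV[R]_d) : y != 0 ->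
  rho (metric_of R th) w y =
  if supported th y (w - y) then (rnorm th y (w - y))%:E else +oo%E.
Proof.
move=> y0; case: th; rewrite /rho /metric_of /supported /rnorm.
- by rewrite norm2E divEFin ?enorm_eq0.
- by rewrite normooE divEFin ?snorm_eq0.
have [h hE] : exists h, h = w - y by exists (w - y).
have Ei i : w 0 i - y 0 i = h 0 i by rewrite hE !mxE.
rewrite -hE.
case: ifPn => [/forallP hs|].
  rewrite -EFin_bigmax; apply: eq_bigr => i _; rewrite Ei.
  have [yi|yi] := eqVneq (y 0 i) 0; last by rewrite divEFin.
  have /implyP := hs i; rewrite yi eqxx => /(_ isT)/eqP ->.
  by rewrite mul0e mul0r abse0 normr0.
rewrite negb_forall => /existsP[i]; rewrite negb_imply => /andP[yi hi].
apply/eqP; rewrite eq_le leey /=.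
apply: (bigmax_sup i) => //; rewrite Ei (eqP yi) inve0.
by move: hi; rewrite neq_lt => /orP[hi|hi];
  [rewrite lt0_muley ?lte_fin|rewrite gt0_muley ?lte_fin].
Qed.

Lemma supportedT (R : realType) d th (y h : 'rV[R]_d) :
  (th = Comp -> forall i, y 0 i != 0) -> supported th y h.
Proof.
case: th => // y0; apply/forallP => i.
by rewrite (negPf (y0 erefl i)).
Qed.

Lemma supportedZ (R : realType) d th a (y h : 'rV[R]_d) :
  supported th y h -> supported th y (a *: h).
Proof.
case: th => // /forallP hs; apply/forallP => i; apply/implyP => yi.
by have /implyP/(_ yi)/eqP hi := hs i; rewrite mxE hi mulr0.
Qed.

Lemma rnorm_ge0 (R : realType) d th (y h : 'rV[R]_d) : 0 <= rnorm th y h.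
Proof.
case: th => /=; last exact: bigmax_ge_id.
- by rewrite divr_ge0 ?enorm_ge0.
- by rewrite divr_ge0 ?snorm_ge0.
Qed.

Lemma rnormZ (R : realType) d th (y h : 'rV[R]_d) a :
  rnorm th y (a *: h) = `|a| * rnorm th y h.
Proof.
case: th => /=; rewrite ?enormZ ?snormZ ?mulrA // -bigmaxZ //.
by apply: eq_bigr => i _; rewrite mxE -mulrA normrM.
Qed.

Lemma ler_rnormD (R : realType) d th (y h k : 'rV[R]_d) :
  rnorm th y (h + k) <= rnorm th y h + rnorm th y k.
Proof.
case: th => /=.
- by rewrite -mulrDl ler_wpM2r ?invr_ge0 ?enorm_ge0 ?ler_enormD.
- by rewrite -mulrDl ler_wpM2r ?invr_ge0 ?snorm_ge0 ?ler_snormD.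
apply: bigmax_le => [|i _]; first by rewrite addr_ge0 ?bigmax_ge_id.
rewrite mxE mulrDl; apply: le_trans (ler_normD _ _) _.
by rewrite lerD //; exact: (le_bigmax _ (fun i => `|_ 0 i / y 0 i|)).
Qed.

Lemma rnorm_le_snorm (R : realType) d th (y : 'rV[R]_d) :
  exists2 C, 0 <= C & forall h, rnorm th y h <= C * snorm h.
Proof.
case: th => /=.
- exists (Num.sqrt d%:R / enorm y).
    by rewrite divr_ge0 ?enorm_ge0 ?sqrtr_ge0.
  by move=> h; rewrite mulrAC ler_wpM2r ?invr_ge0 ?enorm_ge0 ?enorm_le_snorm.
- by exists (snorm y)^-1 => [|h]; rewrite ?invr_ge0 ?snorm_ge0 // mulrC.
exists (\big[Num.max/0]_i `|(y 0 i)^-1|) => [|h]; first exact: bigmax_ge_id.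
apply: bigmax_le => [|i _].
  by rewrite mulr_ge0 ?snorm_ge0 ?bigmax_ge_id.
rewrite normrM mulrC ler_pM ?ler_entry_snorm //.
exact: (le_bigmax _ (fun i => `|(y 0 i)^-1|)).
Qed.

(** Support matters here: where [y 0 i = 0], the componentwise [rnorm] does not see [h 0 i]. *)
Lemma snorm_le_rnorm (R : realType) d th (y : 'rV[R]_d) : y != 0 ->
  exists2 C, 0 < C & forall h, supported th y h -> snorm h <= C * rnorm th y h.
Proof.
move=> y0; case: th => /=.
- exists (enorm y) => [|h _]; first by rewrite enorm_gt0.
  by rewrite mulrC divfK ?enorm_eq0 ?snorm_le_enorm.
- exists (snorm y) => [|h _]; first by rewrite snorm_gt0.
  by rewrite mulrC divfK ?snorm_eq0.
exists (snorm y) => [|h /forallP hs]; first by rewrite snorm_gt0.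
apply: snorm_le => [|i]; first by rewrite mulr_ge0 ?snorm_ge0 ?bigmax_ge_id.
have [yi|yi] := eqVneq (y 0 i) 0.
  have /implyP := hs i; rewrite yi eqxx => /(_ isT)/eqP ->.
  by rewrite normr0 mulr_ge0 ?snorm_ge0 ?bigmax_ge_id.
rewrite -[h 0 i](divfK yi) mulrC normrM ler_pM ?ler_entry_snorm //.
exact: (le_bigmax _ (fun i => `|h 0 i / y 0 i|)).
Qed.

(** The admissible sets grow with [t], so the supremum is nondecreasing in [t] and its right limit
    at 0 is an infimum. *)
Lemma kappaE (R : realType) m n thi tho (f : 'rV[R]_m -> 'rV[R]_n) v :
  kappa thi tho f v =
  ereal_inf [set ereal_sup
    [set (rho tho (f vh) (f v) / rho thi vh v)%E
    | vh in [set vh | (rho thi vh v <= t%:E)%E]] | t in `]0, +oo[].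
Proof.
apply: cvg_lim; first exact: ereal_hausdorff.
apply: nondecreasing_at_right_cvge => // s t _ _ st.
apply: ereal_sup_le => _ [h /= hs <-]; exists h => //=.
by rewrite (le_trans hs) ?lee_fin.
Qed.

(** Covers the perturbation [vh = v]: if [b = 0] then [a = 0], and 0 / 0 = 0. *)
Lemma lee_div (R : realType) (a b M : R) :
  0 <= a -> 0 <= b -> 0 <= M -> a <= M * b -> (a%:E / b%:E <= M%:E)%E.
Proof.
move=> a0 b0 M0; have [->|bn0] := eqVneq b 0.
  rewrite mulr0 => a0'; have -> : a = 0 by apply/le_anti/andP.
  by rewrite mul0e lee_fin.
by rewrite divEFin // lee_fin ler_pdivrMr // lt_def bn0.
Qed.

(** The first-order estimate of Fréchet differentiability at [v], with [L] in the role of the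
    differential. *)
Definition approximates (R : realType) m n (f L : 'rV[R]_m -> 'rV[R]_n) v :=
  forall e, 0 < e -> exists2 r, 0 < r &
    forall h, snorm h <= r -> snorm (f (v + h) - f v - L h) <= e * snorm h.

Section kappa_bounds.
Variables (R : realType) (m n : nat) (thi tho : theta).
Variables (f L : 'rV[R]_m -> 'rV[R]_n) (v : 'rV[R]_m).
Hypotheses (v0 : v != 0) (fv0 : f v != 0).
Hypothesis tho_supp : forall k, supported tho (f v) k.
Hypothesis fL : approximates f L v.

Lemma rnorm_remainder e : 0 < e -> exists2 r, 0 < r &
  forall h, supported thi v h -> rnorm thi v h <= r ->
    rnorm tho (f v) (f (v + h) - f v - L h) <= e * rnorm thi v h.
Proof.
move=> e0; have [C C0 hC] := rnorm_le_snorm tho (f v).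
have [D D0 hD] := snorm_le_rnorm thi v0.
(* The tolerance is divided by both comparison constants; [C + 1] replaces [C], which may vanish. *)
have CD0 : 0 < (C + 1) * D by rewrite mulr_gt0 // ltr_wpDl.
have [r r0 hr] := fL (divr_gt0 e0 CD0).
exists (r / D) => [|h hs hsr]; first by rewrite divr_gt0.
have hDh := hD _ hs.
have hh : snorm h <= r.
  by apply: le_trans hDh _; rewrite mulrC -ler_pdivlMr.
apply: le_trans (hC _) _.
apply: (@le_trans _ _ ((C + 1) * (e / ((C + 1) * D) * (D * rnorm thi v h)))).
  apply: ler_pM => //; rewrite ?snorm_ge0 ?lerDl //.
  apply: le_trans (hr _ hh) _.
  by rewrite ler_wpM2l // divr_ge0 // ltW.
rewrite le_eqVlt; apply/orP; left; apply/eqP; field.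
by rewrite gt_eqF //= gt_eqF // ltr_wpDl.
Qed.

Let kappafv := kappa (metric_of R thi) (metric_of R tho) f v.

Let rhofE h : rho (metric_of R tho) (f (v + h)) (f v) =
  (rnorm tho (f v) (f (v + h) - f v))%:E.
Proof.
by rewrite rhoE // tho_supp.
Qed.

(** Below the radius given by [rnorm_remainder], the ratio is at most [K + e]. Unsupported
    perturbations have infinite input distance and are not admissible. *)
Lemma kappa_le K : 0 <= K ->
  (forall h, supported thi v h -> rnorm tho (f v) (L h) <= K * rnorm thi v h) ->
  (kappafv <= K%:E)%E.
Proof.
move=> K0 hK; rewrite /kappafv kappaE; apply/lee_addgt0Pr => e e0.
have [r r0 hr] := rnorm_remainder e0.
apply: ge_ereal_inf; eexists; first by exists r; [rewrite /= in_itv /= r0|].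
apply/ereal_supP => _ [vh /= hvh <-].
have [h E] : exists h, vh = v + h.
  by exists (vh - v); rewrite addrCA subrr addr0.
move: hvh; rewrite {}E rhofE rhoE // addrC addKr.
case: ifPn => // hs; rewrite lee_fin => hle.
apply: lee_div; rewrite ?rnorm_ge0 ?addr_ge0 ?(ltW e0) //.
rewrite mulrDl -[f (v + h) - f v](subrK (L h)) (addrC _ (L h)).
by apply: le_trans (ler_rnormD _ _ _ _) _; rewrite lerD ?hK ?hr.
Qed.

(** By homogeneity the ratio reached by [L] at [h0] persists at every small multiple of [h0], where
    [f] differs from [L] by a relative error [e]. *)
Lemma kappa_ge K h0 : (forall a h, L (a *: h) = a *: L h) ->
  supported thi v h0 -> 0 < rnorm thi v h0 ->
  K * rnorm thi v h0 <= rnorm tho (f v) (L h0) ->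
  (K%:E <= kappafv)%E.
Proof.
move=> LZ hs h0_gt0 hK; rewrite /kappafv kappaE.
apply/ereal_infP => _ [t /= tI <-]; move: tI; rewrite in_itv /= andbT => t0.
apply/lee_subgt0Pr => e e0; have [r r0 hr] := rnorm_remainder e0.
(* Scales [h0] to size [Num.min r t]: admissible for [t] and within the range of the remainder
   bound. *)
set s := Num.min r t / rnorm thi v h0.
have s0 : 0 < s by rewrite divr_gt0 // lt_min r0.
have sE : rnorm thi v (s *: h0) = Num.min r t.
  by rewrite rnormZ gtr0_norm // /s divfK // gt_eqF.
have ssupp := supportedZ s hs.
have sh0 : v + s *: h0 - v = s *: h0 by rewrite addrC addKr.
apply: le_ereal_sup_tmp.
exists (rho (metric_of R tho) (f (v + s *: h0)) (f v)
        / rho (metric_of R thi) (v + s *: h0) v)%E.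
  exists (v + s *: h0) => //.
  by rewrite /= rhoE // addrC addKr ssupp sE lee_fin ge_min lexx orbT.
have m0 : 0 < Num.min r t by rewrite lt_min r0.
rewrite rhofE rhoE // sh0 ssupp sE divEFin ?gt_eqF // -EFinB lee_fin.
rewrite ler_pdivlMr //.
have := hr _ ssupp; rewrite sE ge_min lexx => /(_ isT) hrem.
(* Reverse triangle inequality: the linear part is the true increment minus the remainder. *)
have LE : L (s *: h0) = (f (v + s *: h0) - f v)
    + (-1) *: (f (v + s *: h0) - f v - L (s *: h0)).
  by rewrite scaleN1r opprB addrCA subrr addr0.
have := ler_rnormD tho (f v) (f (v + s *: h0) - f v)
  ((-1) *: (f (v + s *: h0) - f v - L (s *: h0))).
rewrite -LE LZ !rnormZ normrN1 mul1r gtr0_norm // => htri.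
have : K * Num.min r t <= s * rnorm tho (f v) (L h0).
  rewrite -sE rnormZ gtr0_norm // mulrCA ler_wpM2l //; exact: ltW.
rewrite LZ in hrem => hKs; rewrite mulrBl lerBlDr.
apply: le_trans hKs (le_trans htri _).
by rewrite lerD2l.
Qed.
End kappa_bounds.

(** * Degenerate points: zero input and infinite condition numbers *)

Lemma rho0 (R : realType) d th (w : 'rV[R]_d) :
  rho (metric_of R th) w 0 = if w == 0 then 0%E else +oo%E.
Proof.
case: ifPn => [/eqP ->|w0].
  case: th; rewrite /rho /metric_of ?subrr.
  - by rewrite norm2E (eqP (_ : enorm 0 == 0)) ?enorm_eq0 // mul0e.
  - by rewrite normooE (eqP (_ : snorm 0 == 0)) ?snorm_eq0 // mul0e.
  by apply: bigmax_eq_id => i _; rewrite !mxE subrr mul0e abse0.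
case: th; rewrite /rho /metric_of ?subr0.
- rewrite norm2E (eqP (_ : enorm 0 == 0)) ?enorm_eq0 // inve0.
  by rewrite gt0_muley // lte_fin enorm_gt0.
- rewrite normooE (eqP (_ : snorm 0 == 0)) ?snorm_eq0 // inve0.
  by rewrite gt0_muley // lte_fin snorm_gt0.
have /existsP[i wi] : [exists i, w 0 i != 0].
  rewrite -negb_forall; apply: contra w0 => /forallP h.
  by apply/eqP/rowP => i; rewrite mxE; apply/eqP.
apply/eqP; rewrite eq_le leey /=.
apply: (bigmax_sup i) => //; rewrite mxE subr0 inve0.
by move: wi; rewrite neq_lt => /orP[wi|wi];
  [rewrite lt0_muley ?lte_fin|rewrite gt0_muley ?lte_fin].
Qed.

(** Around 0, [rho] only takes the values 0 and [+oo], so each supremum is over the single ratio 0 /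
    0 = 0. *)
Lemma kappa0 (R : realType) m n thi tho (f : 'rV[R]_m -> 'rV[R]_n) :
  f 0 = 0 -> kappa (metric_of R thi) (metric_of R tho) f 0 = 0%E.
Proof.
move=> f0; rewrite kappaE f0.
have E (t : R) : 0 <= t -> [set (rho (metric_of R tho) (f vh) 0
    / rho (metric_of R thi) vh 0)%E
  | vh in [set vh | (rho (metric_of R thi) vh 0 <= t%:E)%E]] = [set 0%E].
  move=> t0; apply/seteqP; split => [_ [h /= hs <-]|_ ->] /=.
    move: hs; rewrite !rho0; case: (h =P 0) => // -> _.
    by rewrite f0 eqxx mul0e.
  by exists 0; rewrite /= ?rho0 ?f0 ?eqxx ?lee_fin // mul0e.
rewrite (_ : [set _ | _ in _] = [set 0%E]) ?ereal_inf1 //.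
apply/seteqP; split => [_ [t /= tI <-]|_ ->] /=.
  by move: tI; rewrite in_itv /= andbT => /ltW t0; rewrite E ?ereal_sup1.
by exists 1; rewrite ?E ?ereal_sup1 ?ler01 //= in_itv /= ltr01.
Qed.

(** Arbitrarily small perturbations along [h] make a zero output entry nonzero: the output distance
    is infinite and the input distance finite. *)
Lemma kappa_pinfty (R : realType) m n thi (f : 'rV[R]_m -> 'rV[R]_n) v h i :
  v != 0 -> supported thi v h -> f v 0 i = 0 ->
  (forall s, 0 < s -> f (v + s *: h) 0 i != 0) ->
  kappa (metric_of R thi) (metric_of R Comp) f v = +oo%E.
Proof.
move=> v0 hs fvi fhi; rewrite kappaE; apply/eqP; rewrite eq_le leey /=.
apply/ereal_infP => _ [t /= tI <-]; move: tI; rewrite in_itv /= andbT => t0.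
(* The added 1 keeps the denominator positive when [rnorm thi v h] is 0. *)
set s := t / (rnorm thi v h + 1).
have s0 : 0 < s by rewrite divr_gt0 // ltr_wpDl // rnorm_ge0.
have ssupp := supportedZ s hs.
have sh0 : v + s *: h - v = s *: h by rewrite addrC addKr.
have st : rnorm thi v (s *: h) <= t.
  rewrite rnormZ gtr0_norm // /s mulrAC ler_pdivrMr ?ltr_wpDl ?rnorm_ge0 //.
  by rewrite ler_pM2l // lerDl.
apply: le_ereal_sup_tmp.
set w := v + s *: h.
exists (rho (metric_of R Comp) (f w) (f v) / rho (metric_of R thi) w v)%E.
  exists w => //.
  by rewrite /= rhoE // sh0 ssupp lee_fin.
have -> : rho (metric_of R Comp) (f w) (f v) = +oo%E.
  apply/eqP; rewrite eq_le leey /=.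
  apply: (bigmax_sup i) => //; rewrite fvi subr0 inve0.
  have := fhi _ s0; rewrite neq_lt => /orP[wi|wi];
    by [rewrite lt0_muley ?lte_fin|rewrite gt0_muley ?lte_fin].
rewrite rhoE // sh0 ssupp gt0_mulye // inver.
by case: eqP => // /eqP h0; rewrite lte_fin invr_gt0 lt_def h0 rnorm_ge0.
Qed.

(** * Linear approximation of RN *)

Lemma inv_diff_bound (R : realType) (a b c : R) : 0 < c -> c <= a -> c <= b ->
  `|b^-1 - a^-1| <= `|b ^+ 2 - a ^+ 2| / (2 * c ^+ 3).
Proof.
move=> c0 ca cb; have a0 := lt_le_trans c0 ca; have b0 := lt_le_trans c0 cb.
have -> : b^-1 - a^-1 = - ((b ^+ 2 - a ^+ 2) / (a * b * (a + b))).
  by field; rewrite !gt_eqF //= addr_gt0.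
have p0 : 0 < a * b * (a + b) by rewrite !mulr_gt0 // addr_gt0.
rewrite normrN normrM normfV (gtr0_norm p0) ler_wpM2l // lef_pV2 ?posrE //;
  last by rewrite mulr_gt0 // exprn_gt0.
have -> : 2 * c ^+ 3 = c * c * (c + c) by ring.
by rewrite !ler_pM ?mulr_ge0 ?addr_ge0 ?lerD // ltW.
Qed.

(** Taylor expansion of the inverse square root at [a ^+ 2], with increment [b ^+ 2 - a ^+ 2]. The
    exact remainder is a rational function of [a] and [b], so the bound is algebraic. *)
Lemma inv_taylor_bound (R : realType) (a b c : R) :
  0 < c -> c <= a -> c <= b ->
  `|b^-1 - a^-1 + (b ^+ 2 - a ^+ 2) / (2 * a ^+ 3)|
    <= (b ^+ 2 - a ^+ 2) ^+ 2 / (2 * c ^+ 5).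
Proof.
move=> c0 ca cb; have a0 := lt_le_trans c0 ca; have b0 := lt_le_trans c0 cb.
have ab0 : 0 < a + b by rewrite addr_gt0.
have -> : b^-1 - a^-1 + (b ^+ 2 - a ^+ 2) / (2 * a ^+ 3)
    = (b ^+ 2 - a ^+ 2) ^+ 2 *
      ((b + 2 * a) / (2 * (a + b)) / (a * a * a * b * (a + b))).
  by field; rewrite !gt_eqF.
have q0 : 0 <= (b + 2 * a) / (2 * (a + b)) / (a * a * a * b * (a + b)).
  by rewrite !divr_ge0 ?mulr_ge0 ?addr_ge0 ?mulr_ge0 // ltW.
rewrite ger0_norm; last exact: mulr_ge0 (sqr_ge0 _) q0.
rewrite ler_wpM2l ?sqr_ge0 //.
have c5 : 0 < 2 * c ^+ 5 by rewrite mulr_gt0 // exprn_gt0.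
rewrite ler_pdivrMr; last by rewrite !mulr_gt0.
apply: (@le_trans _ _ 1).
  by rewrite ler_pdivrMr ?mulr_gt0 // mul1r mulrDr; lra.
rewrite mulrC ler_pdivlMr // mul1r.
have -> : 2 * c ^+ 5 = c * c * c * c * (c + c) by ring.
by rewrite !ler_pM ?mulr_ge0 ?addr_ge0 ?lerD // ltW.
Qed.

(* sqrt (|x|^2 + eps) times the Jacobian of RN with g = 1 at x. *)
Definition rnjac (R : realType) d (eps : R) (x h : 'rV[R]_d) : 'rV[R]_d :=
  h - (dotp x h / (dotp x x + eps)) *: x.

Lemma RNE (R : realType) d (g : 'rV[R]_d) eps y :
  RN g eps y = (Num.sqrt (dotp y y + eps))^-1 *: hadamard g y.
Proof. by rewrite /RN norm2E enorm_sqr. Qed.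

(** The remainder is bounded by [C * t ^+ 2] with [t = snorm h]. All square roots involved are at
    least [c = Num.sqrt eps], which keeps their inverses bounded. *)
Lemma approximates_RN (R : realType) d (g : 'rV[R]_d) eps x : 0 < eps ->
  approximates (RN g eps)
    (fun h => (Num.sqrt (dotp x x + eps))^-1 *: hadamard g (rnjac eps x h)) x.
Proof.
move=> eps0 e e0; set c := Num.sqrt eps; set a := Num.sqrt (dotp x x + eps).
have c0 : 0 < c by rewrite sqrtr_gt0.
have sE y : Num.sqrt (dotp y y + eps) ^+ 2 = dotp y y + eps.
  by rewrite sqr_sqrtr // addr_ge0 ?dotp_ge0 // ltW.
have sc (y : 'rV[R]_d) : c <= Num.sqrt (dotp y y + eps).
  by rewrite ler_wsqrtr // lerDr dotp_ge0.
have a0 : 0 < a by exact: lt_le_trans (sc x).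
(* Chosen so that [b ^+ 2 - a ^+ 2 = 2 * q + dotp h h] is at most [M * t] in absolute value once
   [t <= 1]; hence the 1 in the radius below. *)
pose M := 2 * (enorm x * Num.sqrt d%:R) + d%:R.
have M0 : 0 <= M.
  by rewrite addr_ge0 // !mulr_ge0 ?enorm_ge0 ?sqrtr_ge0.
pose C := snorm g * (M / (2 * c ^+ 3)
  + snorm x * (M ^+ 2 / (2 * c ^+ 5) + d%:R / (2 * c ^+ 3))).
have c3 : 0 < (2 * c ^+ 3)^-1 by rewrite invr_gt0 mulr_gt0 // exprn_gt0.
have c5 : 0 < (2 * c ^+ 5)^-1 by rewrite invr_gt0 mulr_gt0 // exprn_gt0.
have C0 : 0 <= C.
  apply: mulr_ge0 (snorm_ge0 _) (addr_ge0 (mulr_ge0 M0 (ltW c3)) _).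
  apply: mulr_ge0 (snorm_ge0 _) (addr_ge0 (mulr_ge0 (sqr_ge0 _) (ltW c5)) _).
  exact: mulr_ge0 (ler0n _ _) (ltW c3).
have C10 : 0 < C + 1 by rewrite ltr_wpDl.
exists (Num.min 1 (e / (C + 1))) => [|h].
  by rewrite lt_min ltr01 divr_gt0.
rewrite le_min => /andP[h1 he]; set t := snorm h in h1 he *.
have t0 : 0 <= t := snorm_ge0 h.
suff hC : snorm (RN g eps (x + h) - RN g eps x
    - a^-1 *: hadamard g (rnjac eps x h)) <= C * t ^+ 2.
  apply: le_trans hC _; rewrite expr2 mulrA ler_wpM2r //.
  move: he; rewrite ler_pdivlMr // => he; apply: le_trans he.
  by rewrite mulrC ler_wpM2l // lerDl.
set q := dotp x h; set b := Num.sqrt (dotp (x + h) (x + h) + eps).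
have bE : b ^+ 2 - a ^+ 2 = 2 * q + dotp h h.
  by rewrite !sE !(dotpDl, dotpDr) (dotpC h x) -/q; ring.
have hh : dotp h h <= d%:R * t ^+ 2.
  rewrite -enorm_sqr -[d%:R]sqr_sqrtr // -exprMn.
  by apply: lerXn2r; rewrite ?nnegrE ?mulr_ge0 ?enorm_ge0 ?enorm_le_snorm.
have qM : `|q| <= enorm x * Num.sqrt d%:R * t.
  apply: le_trans (cauchy_schwarz _ _) _; rewrite -mulrA.
  by rewrite ler_wpM2l ?enorm_ge0 ?enorm_le_snorm.
have DM : `|b ^+ 2 - a ^+ 2| <= M * t.
  rewrite bE; apply: le_trans (ler_normD _ _) _.
  rewrite /M (mulrDl _ _ t) lerD //.
    by rewrite normrM ger0_norm // -mulrA ler_wpM2l.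
  rewrite ger0_norm ?dotp_ge0 //; apply: le_trans hh _.
  by rewrite ler_wpM2l // expr2 -[leRHS]mulr1 ler_wpM2l.
have h1' := inv_diff_bound c0 (sc x) (sc (x + h)).
have h2' := inv_taylor_bound c0 (sc x) (sc (x + h)).
rewrite -/a -/b in h1' h2'.
have {}h1' : `|b^-1 - a^-1| <= M / (2 * c ^+ 3) * t.
  by apply: le_trans h1' _; rewrite [leRHS]mulrAC ler_wpM2r // ltW.
have {h2'} h2 : `|b^-1 - a^-1 + q / a ^+ 3|
    <= (M ^+ 2 / (2 * c ^+ 5) + d%:R / (2 * c ^+ 3)) * t ^+ 2.
  (* Only the part [2 * q] of the increment is linear in [h]; dropping [dotp h h] costs the term
     [d%:R / (2 * c ^+ 3)] of [C]. *)
  have -> : b^-1 - a^-1 + q / a ^+ 3 =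
      (b^-1 - a^-1 + (b ^+ 2 - a ^+ 2) / (2 * a ^+ 3))
      - dotp h h / (2 * a ^+ 3).
    by rewrite bE; field; rewrite !gt_eqF //; exact: lt_le_trans (sc _).
  apply: le_trans (ler_normB _ _) _; rewrite (mulrDl _ _ (t ^+ 2)) lerD //.
    apply: le_trans h2' _; rewrite [leRHS]mulrAC ler_wpM2r ?(ltW c5) // -exprMn.
    rewrite -real_normK ?num_real //.
    by apply: lerXn2r; rewrite ?nnegrE ?mulr_ge0.
  rewrite ger0_norm; last first.
    by rewrite divr_ge0 ?dotp_ge0 // mulr_ge0 // exprn_ge0 // ltW.
  rewrite [leRHS]mulrAC ler_pM ?dotp_ge0 ?invr_ge0 //.
    by rewrite mulr_ge0 // exprn_ge0 // ltW.
  rewrite lef_pV2 ?posrE ?mulr_gt0 ?exprn_gt0 // ler_wpM2l //.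
  by apply: lerXn2r; rewrite ?nnegrE ?(ltW a0) ?(ltW c0) //; exact: sc.
apply: snorm_le => [|i]; first by rewrite mulr_ge0 ?sqr_ge0.
(* Both summands are quadratic in [t]: a product of two first-order quantities, and a Taylor
   remainder. *)
have -> : (RN g eps (x + h) - RN g eps x
    - a^-1 *: hadamard g (rnjac eps x h)) 0 i =
  g 0 i * (h 0 i * (b^-1 - a^-1) + x 0 i * (b^-1 - a^-1 + q / a ^+ 3)).
  rewrite !RNE -/a -/b !(mxE, hadamardE) -/q -sE -/a.
  by field; rewrite !gt_eqF //; exact: lt_le_trans (sc _).
rewrite /C normrM -mulrA ler_pM ?ler_entry_snorm //.
apply: le_trans (ler_normD _ _) _.
rewrite (mulrDl _ _ (t ^+ 2)) lerD // !normrM.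
  rewrite expr2 mulrA mulrC ler_pM //; exact: ler_entry_snorm.
by rewrite -mulrA ler_pM ?ler_entry_snorm.
Qed.

Lemma rnjacZ (R : realType) d (eps : R) (x : 'rV[R]_d) a h :
  rnjac eps x (a *: h) = a *: rnjac eps x h.
Proof. by rewrite /rnjac dotpZr scalerBr scalerA mulrA. Qed.

Lemma dotp_rnjac (R : realType) d (eps : R) (x w h : 'rV[R]_d) :
  dotp w (rnjac eps x h) = dotp (rnjac eps x w) h.
Proof.
rewrite /rnjac dotpBr dotpBl dotpZr dotpZl (dotpC w x); congr (_ - _).
by rewrite mulrAC [RHS]mulrAC; congr (_ / _); exact: mulrC.
Qed.

(** By symmetry of [J], its row [i] is the image of the [i]-th basis vector. *)
Lemma rnjacE (R : realType) d (eps : R) (x h : 'rV[R]_d) i :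
  rnjac eps x h 0 i = dotp (rnjac eps x (delta_mx 0 i)) h.
Proof. by rewrite -dotp_rnjac dotp_deltal. Qed.

(** With [S = dotp x x + eps] and [q = dotp x h], expanding gives [- 2 * q ^+ 2 / S + dotp x x * q
    ^+ 2 / S ^+ 2]; substituting [dotp x x = S - eps] produces the factor [1 + eps / S]. *)
Lemma enorm_rnjac (R : realType) d (eps : R) (x h : 'rV[R]_d) : 0 < eps ->
  enorm (rnjac eps x h) = Num.sqrt (dotp h h -
    (1 + eps / (dotp x x + eps)) * (dotp x h ^+ 2 / (dotp x x + eps))).
Proof.
move=> eps0; congr Num.sqrt.
rewrite /rnjac !(dotpBl, dotpBr, dotpZl, dotpZr) (dotpC h x).
field; rewrite gt_eqF // ltr_wpDl ?dotp_ge0 //.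
Qed.

Lemma enorm_rnjac_le (R : realType) d (eps : R) (x h : 'rV[R]_d) : 0 < eps ->
  enorm (rnjac eps x h) <= enorm h.
Proof.
move=> eps0; rewrite enorm_rnjac // ler_wsqrtr // gerBl.
have S0 : 0 < dotp x x + eps by rewrite ltr_wpDl ?dotp_ge0.
apply: mulr_ge0; last by rewrite divr_ge0 ?sqr_ge0 // ltW.
exact: addr_ge0 ler01 (divr_ge0 (ltW eps0) (ltW S0)).
Qed.

(** * Sign vectors and dual norms *)

Lemma dotp_signs (R : realType) d (u y : 'rV[R]_d) :
  exists s, dotp u (hadamard y (signs R s)) = \sum_j `|y 0 j * u 0 j|.
Proof.
exists [ffun j => y 0 j * u 0 j < 0]; rewrite dotpE.
apply: eq_bigr => j _; rewrite hadamardE mxE ffunE mulrCA mulrA mulrC mulr_sign.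
by case: ltrgt0P.
Qed.

Lemma normr_signs (R : realType) d s (i : 'I_d) : `|signs R s 0 i| = 1.
Proof. by rewrite mxE normrX normrN1 expr1n. Qed.

Lemma snorm_signs (R : realType) d (s : {ffun 'I_d -> bool}) : (0 < d)%N ->
  snorm (signs R s) = 1.
Proof.
move=> d0; apply/le_anti/andP; split.
  by apply: snorm_le => // i; rewrite normr_signs.
by rewrite -(normr_signs R s (Ordinal d0)) ler_entry_snorm.
Qed.

Lemma dotp_le_snorm (R : realType) d (u h : 'rV[R]_d) :
  `|dotp u h| <= (\sum_j `|u 0 j|) * snorm h.
Proof.
rewrite dotpE; apply: le_trans (ler_norm_sum _ _ _) _.
rewrite mulr_suml; apply: ler_sum => j _.
by rewrite normrM ler_wpM2l ?ler_entry_snorm.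
Qed.

Lemma rV_neq0 (R : realType) d (x : 'rV[R]_d) : x != 0 -> exists i, x 0 i != 0.
Proof.
move=> x0; apply/existsP; rewrite -negb_forall; apply: contra x0.
by move/forallP => h; apply/eqP/rowP => i; rewrite mxE; apply/eqP.
Qed.

Lemma rV_neq0_gt0 (R : realType) d (x : 'rV[R]_d) : x != 0 -> (0 < d)%N.
Proof. by case/rV_neq0 => i _; exact: leq_ltn_trans (ltn_ord i). Qed.

Lemma rnorm_Comp (R : realType) d (x h : 'rV[R]_d) :
  rnorm Comp x h = snorm (\row_i (h 0 i / x 0 i)).
Proof. by apply: eq_bigr => i _; rewrite mxE. Qed.

(** Substituting [h = hadamard x k] turns the componentwise measure of [h] into [snorm k], so this
    case reduces to a box. *)
Lemma supported_Comp (R : realType) d (x h : 'rV[R]_d) : supported Comp x h ->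
  h = hadamard x (\row_i (h 0 i / x 0 i)).
Proof.
move=> /forallP hs; apply/rowP => i; rewrite hadamardE mxE mulrC.
have [xi|xi] := eqVneq (x 0 i) 0; last by rewrite divfK.
by have /implyP := hs i; rewrite xi eqxx => /(_ isT)/eqP ->; rewrite mulr0.
Qed.

Lemma supported_hadamard (R : realType) d (x h : 'rV[R]_d) :
  supported Comp x (hadamard x h).
Proof.
by apply/forallP => i; apply/implyP => /eqP xi; rewrite hadamardE xi mul0r.
Qed.

Lemma rnorm_Comp_signs (R : realType) d (x : 'rV[R]_d) s : x != 0 ->
  rnorm Comp x (hadamard x (signs R s)) = 1.
Proof.
move=> x0; have E i : x 0 i != 0 ->
    `|hadamard x (signs R s) 0 i / x 0 i| = 1.
  by move=> xi; rewrite hadamardE mulrAC divff // mul1r normr_signs.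
apply/le_anti/andP; split.
  apply: bigmax_le => // i _.
  have [xi|xi] := eqVneq (x 0 i) 0; last by rewrite E.
  by rewrite hadamardE xi !mul0r normr0.
have [i xi] := rV_neq0 x0; rewrite -(E _ xi).
exact: (le_bigmax _ (fun i => `|hadamard x (signs R s) 0 i / x 0 i|)).
Qed.

(** The dual norm of [rnorm th x] over supported vectors, for [x != 0]; the next lemmas prove the
    bound and that it is attained. *)
Definition dualnorm (R : realType) d th (x u : 'rV[R]_d) : R :=
  match th with
  | Two => enorm x * enorm u
  | Infty => snorm x * \sum_j `|u 0 j|
  | Comp => \sum_j `|x 0 j * u 0 j|
  end.

Lemma dualnorm_ge0 (R : realType) d th (x u : 'rV[R]_d) : 0 <= dualnorm th x u.
Proof.
case: th => /=; rewrite ?mulr_ge0 ?enorm_ge0 ?snorm_ge0 //; exact: sumr_ge0.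
Qed.

Lemma dotp_hadamard (R : realType) d (u x h : 'rV[R]_d) :
  dotp u (hadamard x h) = dotp (hadamard x u) h.
Proof.
by rewrite !dotpE; apply: eq_bigr => i _; rewrite !hadamardE mulrCA mulrA.
Qed.

Lemma dualnorm_le (R : realType) d th (x u h : 'rV[R]_d) : x != 0 ->
  supported th x h -> `|dotp u h| <= dualnorm th x u * rnorm th x h.
Proof.
move=> x0; case: th => /=.
- by rewrite mulrC mulrA divfK ?enorm_eq0 // mulrC cauchy_schwarz.
- by rewrite mulrC mulrA divfK ?snorm_eq0 // mulrC dotp_le_snorm.
move=> hs; rewrite -/(rnorm Comp x h) rnorm_Comp [in leLHS](supported_Comp hs).
rewrite dotp_hadamard; apply: le_trans (dotp_le_snorm _ _) _.
rewrite ler_wpM2r ?snorm_ge0 // ler_sum // => j _.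
by rewrite hadamardE.
Qed.

Lemma dualnorm_attained (R : realType) d th (x u : 'rV[R]_d) : x != 0 ->
  exists h, [/\ supported th x h, 0 < rnorm th x h &
    dualnorm th x u * rnorm th x h <= `|dotp u h|].
Proof.
move=> x0; case: th.
- have [->|u0] := eqVneq u 0.
    (* For [u = 0] any nonzero direction will do. *)
    exists x; split => //=; first by rewrite divff ?enorm_eq0.
    by rewrite (eqP (_ : enorm 0 == 0)) ?enorm_eq0 // mulr0 mul0r.
  exists u; split => //=; first by rewrite divr_gt0 ?enorm_gt0.
  rewrite mulrC mulrA divfK ?enorm_eq0 // -expr2 enorm_sqr ger0_norm //.
  exact: dotp_ge0.
- have [s hs] := dotp_signs u (const_mx 1).
  exists (signs R s).
  have E : hadamard (const_mx 1) (signs R s) = signs R s.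
    by apply/rowP => i; rewrite hadamardE mxE mul1r.
  split => //=.
    by rewrite snorm_signs ?(rV_neq0_gt0 x0) // div1r invr_gt0 snorm_gt0.
  rewrite snorm_signs ?(rV_neq0_gt0 x0) // div1r mulrAC divff ?snorm_eq0 //.
  rewrite mul1r; apply: le_trans (ler_norm _); rewrite -E hs.
  by rewrite ler_sum // => i _; rewrite mxE mul1r.
have [s hs] := dotp_signs u x; exists (hadamard x (signs R s)); split.
- exact: supported_hadamard.
- by rewrite rnorm_Comp_signs.
by rewrite rnorm_Comp_signs // mulr1 hs /= ler_norm.
Qed.

Section RN_kappa.
Variables (R : realType) (d : nat) (g : 'rV[R]_d) (eps : R) (x : 'rV[R]_d).
Hypotheses (g0 : forall i, g 0 i != 0) (eps0 : 0 < eps) (x0 : x != 0).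
Let S := dotp x x + eps.
Let a := Num.sqrt S.

Lemma RN_neq0 : RN g eps x != 0.
Proof.
rewrite RNE scaler_eq0 negb_or invr_eq0 sqrtr_eq0 -ltNge.
by rewrite ltr_wpDl ?dotp_ge0 //= hadamard_eq0.
Qed.

Let L h := a^-1 *: hadamard g (rnjac eps x h).

Let LZ c h : L (c *: h) = c *: L h.
Proof.
rewrite /L rnjacZ scalerA mulrC -scalerA; congr (_ *: _).
by apply/rowP => i; rewrite !(mxE, hadamardE) mulrCA.
Qed.

Let a_gt0 : 0 < a.
Proof. by rewrite sqrtr_gt0 ltr_wpDl ?dotp_ge0. Qed.

Let kap thi tho := kappa (metric_of R thi) (metric_of R tho) (RN g eps) x.

(** The condition on [tho = Comp] makes all output entries nonzero, so every output distance is
    finite. *)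
Lemma kappa_RN_le thi tho K : (tho = Comp -> forall i, x 0 i != 0) -> 0 <= K ->
  (forall h, supported thi x h ->
     rnorm tho (RN g eps x) (L h) <= K * rnorm thi x h) ->
  (kap thi tho <= K%:E)%E.
Proof.
move=> ht; apply: kappa_le => //; first exact: RN_neq0; last first.
  exact: approximates_RN.
move=> k; apply: supportedT => /ht xi i.
by rewrite RNE mxE hadamardE !mulf_neq0 // invr_eq0 gt_eqF.
Qed.

Lemma kappa_RN_ge thi tho K h0 : (tho = Comp -> forall i, x 0 i != 0) ->
  supported thi x h0 -> 0 < rnorm thi x h0 ->
  K * rnorm thi x h0 <= rnorm tho (RN g eps x) (L h0) ->
  (K%:E <= kap thi tho)%E.
Proof.
move=> ht; apply: kappa_ge => //; first exact: RN_neq0; last first.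
  exact: approximates_RN.
move=> k; apply: supportedT => /ht xi i.
by rewrite RNE mxE hadamardE !mulf_neq0 // invr_eq0 gt_eqF.
Qed.

(** The output norm is a maximum of absolute values of linear forms, so the two maxima over [h] and
    over [i] can be exchanged; each form contributes its dual norm. *)
Lemma kappa_RN_bigmax thi tho (w : 'I_d -> R) :
  (tho = Comp -> forall i, x 0 i != 0) ->
  (forall h, rnorm tho (RN g eps x) (L h)
     = \big[Num.max/0]_i `|w i * rnjac eps x h 0 i|) ->
  kap thi tho = (\big[Num.max/0]_i
    (`|w i| * dualnorm thi x (rnjac eps x (delta_mx 0 i))))%:E.
Proof.
move=> ht hL; have [i0 _] := rV_neq0 x0.
have F0 i : 0 <= `|w i| * dualnorm thi x (rnjac eps x (delta_mx 0 i)).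
  by rewrite mulr_ge0 ?dualnorm_ge0.
apply/le_anti/andP; split.
  apply: kappa_RN_le => // [|h hs]; first exact: bigmax_ge_id.
  rewrite hL; apply: bigmax_le => [|i _].
    by rewrite mulr_ge0 ?rnorm_ge0 ?bigmax_ge_id.
  rewrite normrM rnjacE.
  apply: (@le_trans _ _ (`|w i| * dualnorm thi x (rnjac eps x (delta_mx 0 i))
    * rnorm thi x h)).
    by rewrite -mulrA ler_wpM2l // dualnorm_le.
  rewrite ler_wpM2r ?rnorm_ge0 //.
  exact: (le_bigmax _
    (fun i => `|w i| * dualnorm thi x (rnjac eps x (delta_mx 0 i)))).
(* Lower bound: take a row with the largest weighted dual norm and a perturbation extremal for
   it. *)
have [i _ ->] := eq_bigmax i0 xpredT _ isT (fun i _ => F0 i).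
have [h [hs h_gt0 hd]] :=
  dualnorm_attained thi (rnjac eps x (delta_mx 0 i)) x0.
apply: (kappa_RN_ge ht hs h_gt0); rewrite hL -mulrA.
apply: (bigmax_sup i) => //.
by rewrite normrM rnjacE ler_wpM2l.
Qed.

Lemma kappa_RN_Infty thi : kap thi Infty = (\big[Num.max/0]_i
    (`|g 0 i| * dualnorm thi x (rnjac eps x (delta_mx 0 i)))
    / snorm (hadamard g x))%:E.
Proof.
rewrite (@kappa_RN_bigmax _ _ (fun i => g 0 i / snorm (hadamard g x))) //.
  rewrite [in RHS]mulrC -bigmaxZ ?invr_ge0 ?snorm_ge0 //.
  congr (_%:E); apply: eq_bigr => i _.
  rewrite normrM mulrAC mulrC; congr (_ * _).
  by rewrite ger0_norm // invr_ge0 snorm_ge0.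
move=> h /=; rewrite RNE /L !snormZ -/a.
rewrite -mulf_div divff ?mul1r ?normr_eq0 ?invr_eq0 ?gt_eqF //.
rewrite mulrC -bigmaxZ ?invr_ge0 ?snorm_ge0 //; apply: eq_bigr => i _.
rewrite hadamardE [in RHS]mulrAC [RHS]normrM mulrC; congr (_ * _).
by rewrite ger0_norm // invr_ge0 snorm_ge0.
Qed.

(** Entrywise division by [RN g eps x] cancels [g] and leaves the weights [(x 0 i)^-1]. *)
Lemma kappa_RN_Comp thi : (forall i, x 0 i != 0) ->
  kap thi Comp = (\big[Num.max/0]_i
    (`|x 0 i|^-1 * dualnorm thi x (rnjac eps x (delta_mx 0 i))))%:E.
Proof.
move=> xi; rewrite (@kappa_RN_bigmax _ _ (fun i => (x 0 i)^-1)) //.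
  by congr (_%:E); apply: eq_bigr => i _; rewrite normfV.
move=> h /=; apply: eq_bigr => i _.
rewrite RNE -/a /L; move: (rnjac eps x h) => p.
rewrite !(mxE, hadamardE); congr `|_|.
by field; rewrite g0 xi (gt_eqF a_gt0).
Qed.

Lemma rnorm_Two_L h : rnorm Two (RN g eps x) (L h)
  = enorm (hadamard g (rnjac eps x h)) / enorm (hadamard g x).
Proof.
rewrite /= RNE !enormZ -/a.
by rewrite -mulf_div divff ?mul1r // normr_eq0 invr_eq0 gt_eqF.
Qed.

End RN_kappa.

Lemma hadamard_const (R : realType) d c (y : 'rV[R]_d) :
  hadamard (const_mx c) y = c *: y.
Proof. by apply/rowP => i; rewrite hadamardE !mxE. Qed.

Lemma snorm_const (R : realType) d (c : R) : (0 < d)%N ->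
  snorm (const_mx c : 'rV[R]_d) = `|c|.
Proof.
move=> d0; apply/le_anti/andP; split.
  by apply: snorm_le => // i; rewrite mxE.
have := ler_entry_snorm (const_mx c : 'rV[R]_d) (Ordinal d0).
by rewrite mxE.
Qed.

Lemma enorm0 (R : realType) d : enorm (0 : 'rV[R]_d) = 0.
Proof. by apply/eqP; rewrite enorm_eq0. Qed.

Lemma snorm0 (R : realType) d : snorm (0 : 'rV[R]_d) = 0.
Proof. by apply/eqP; rewrite snorm_eq0. Qed.

Lemma hadamard0 (R : realType) d (g : 'rV[R]_d) : hadamard g 0 = 0.
Proof. by apply/rowP => i; rewrite hadamardE mxE mulr0. Qed.

Lemma RN0 (R : realType) d (g : 'rV[R]_d) eps : RN g eps 0 = 0.
Proof. by rewrite /RN hadamard0 scaler0. Qed.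

(** * Extremal values of the linear approximation *)

(* With [w = J (y o h)], [J] symmetric, and [s] the signs of [y o J w]:
   [|w|^2 = <y o J w, h> <= <J w, y o s> |h|_oo = <w, J (y o s)> |h|_oo]. *)
Lemma enorm_rnjac_box (R : realType) d eps (x y h : 'rV[R]_d) :
  enorm (rnjac eps x (hadamard y h)) <=
  (\big[Num.max/0]_s enorm (rnjac eps x (hadamard y (signs R s)))) * snorm h.
Proof.
set w := rnjac eps x (hadamard y h).
have [->|w0] := eqVneq w 0.
  by rewrite enorm0 mulr_ge0 ?bigmax_ge_id ?snorm_ge0.
have [s hs] := dotp_signs (rnjac eps x w) y.
have ws : enorm w ^+ 2 <=
    enorm w * (enorm (rnjac eps x (hadamard y (signs R s))) * snorm h).
  rewrite enorm_sqr {2}/w dotp_rnjac dotp_hadamard mulrA.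
  apply: le_trans (ler_norm _) (le_trans (dotp_le_snorm _ _) _).
  rewrite ler_wpM2r ?snorm_ge0 //.
  under eq_bigr do rewrite hadamardE.
  rewrite -hs -dotp_rnjac.
  exact: le_trans (ler_norm _) (cauchy_schwarz _ _).
have w_gt0 : 0 < enorm w by rewrite enorm_gt0.
move: ws; rewrite expr2 ler_pM2l // => /le_trans; apply.
rewrite ler_wpM2r ?snorm_ge0 //.
exact: (le_bigmax _ (fun s => enorm (rnjac eps x (hadamard y (signs R s))))).
Qed.

(** Computes the weighted 1-norm of a row of [J]: [y] is all ones for a sup-norm input and [x] for a
    componentwise one. The diagonal entry is nonnegative because [x 0 i ^+ 2 <= S], which is what
    gives the coefficient [- 2]. *)
Lemma sum_rnjac_delta (R : realType) d eps (x y : 'rV[R]_d) i : 0 < eps ->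
  \sum_j `|y 0 j * rnjac eps x (delta_mx 0 i) 0 j| =
  `|y 0 i| + `|x 0 i| *
    (\sum_j `|x 0 j * y 0 j| - 2 * (`|x 0 i| * `|y 0 i|)) / (dotp x x + eps).
Proof.
move=> eps0; set S := dotp x x + eps.
have S0 : 0 < S by rewrite ltr_wpDl ?dotp_ge0.
have E j : rnjac eps x (delta_mx 0 i) 0 j = (i == j)%:R - x 0 i / S * x 0 j.
  by rewrite /rnjac dotpC dotp_deltal !mxE eqxx eq_sym.
have xS : `|x 0 i| ^+ 2 <= S.
  rewrite real_normK ?num_real // /S dotpE (bigD1 i) //= -expr2 -addrA lerDl.
  rewrite addr_ge0 ?(ltW eps0) // sumr_ge0 // => j _.
  by rewrite -expr2 sqr_ge0.
rewrite (bigD1 i) //= [in RHS](bigD1 i) //= E eqxx.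
have -> : \sum_(j < d | j != i) `|y 0 j * rnjac eps x (delta_mx 0 i) 0 j|
    = `|x 0 i| / S * \sum_(j < d | j != i) `|x 0 j * y 0 j|.
  rewrite mulr_sumr; apply: eq_bigr => j /negPf ji.
  rewrite E eq_sym ji sub0r mulrN normrN -[S in RHS]gtr0_norm // -normfV.
  by rewrite -!normrM; congr `|_|; ring.
rewrite !normrM.
have -> : `|1%:R - x 0 i / S * x 0 i| = 1 - `|x 0 i| ^+ 2 / S.
  rewrite real_normK ?num_real // mulrAC -expr2 ger0_norm //.
  by rewrite subr_ge0 ler_pdivrMr // mul1r -(real_normK (num_real (x 0 i))).
by field; rewrite gt_eqF.
Qed.

Lemma enorm_rnjac_delta (R : realType) d eps (x : 'rV[R]_d) i : 0 < eps ->
  enorm (rnjac eps x (delta_mx 0 i)) = Num.sqrt (1 -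
    (1 + eps / (dotp x x + eps)) * (x 0 i ^+ 2 / (dotp x x + eps))).
Proof.
by move=> eps0; rewrite enorm_rnjac // (dotpC x) !dotp_deltal mxE !eqxx.
Qed.

Lemma dualnorm_Infty_delta (R : realType) d eps (x : 'rV[R]_d) i : 0 < eps ->
  dualnorm Infty x (rnjac eps x (delta_mx 0 i)) =
  snorm x * (1 + `|x 0 i| * (norm1 x - 2 * `|x 0 i|) / (dotp x x + eps)).
Proof.
move=> eps0; have E j : (const_mx 1 : 'rV[R]_d) 0 j = 1 by rewrite mxE.
have := sum_rnjac_delta x (const_mx 1) i eps0.
under eq_bigr do rewrite E mul1r.
under [in RHS]eq_bigr do rewrite E mulr1.
by rewrite E normr1 mulr1 norm1E /dualnorm => ->.
Qed.

Lemma dualnorm_Comp_delta (R : realType) d eps (x : 'rV[R]_d) i : 0 < eps ->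
  dualnorm Comp x (rnjac eps x (delta_mx 0 i)) =
  `|x 0 i| * (2 * (1 - (x 0 i ^+ 2 + eps / 2) / (dotp x x + eps))).
Proof.
move=> eps0; rewrite /= sum_rnjac_delta //.
have -> : \sum_j `|x 0 j * x 0 j| = dotp x x.
  by rewrite dotpE; apply: eq_bigr => j _; rewrite ger0_norm // -expr2 sqr_ge0.
rewrite -[_ * _ in X in _ - 2 * X]expr2 real_normK ?num_real //.
by field; rewrite gt_eqF // ltr_wpDl ?dotp_ge0.
Qed.

Lemma normNooP (R : realType) d (x : 'rV[R]_d) : (0 < d)%N ->
  exists2 i, normNoo x = `|x 0 i| & forall j, `|x 0 i| <= `|x 0 j|.
Proof.
move=> d0; have xb i : `|x 0 i| <= normoo x by rewrite normooE ler_entry_snorm.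
have [i _ iE] := eq_bigmin (Ordinal d0) xpredT _ isT (fun i _ => xb i).
by exists i => // j; rewrite -iE; exact: bigmin_le.
Qed.

(** Monotonicity is asked only at the values [|x 0 i|], since the functions [phi] used below contain
    inverses and are not monotone across 0. *)
Lemma bigmax_normNoo (R : realType) d (x : 'rV[R]_d) (phi : R -> R) :
  (0 < d)%N -> (forall i, 0 <= phi `|x 0 i|) ->
  (forall i j, `|x 0 i| <= `|x 0 j| -> phi `|x 0 j| <= phi `|x 0 i|) ->
  \big[Num.max/0]_i phi `|x 0 i| = phi (normNoo x).
Proof.
move=> d0 p0 pm; have [i -> hi] := normNooP x d0.
apply/le_anti/andP; split.
  by apply: bigmax_le => // j _; apply: pm.
exact: (le_bigmax _ (fun i => phi `|x 0 i|)).
Qed.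

(** * Condition numbers of RN *)

Section RN_condition_numbers.
Variables (R : realType) (d : nat) (g : 'rV[R]_d) (eps : R) (x : 'rV[R]_d).
Hypotheses (d0 : (0 < d)%N) (g0 : forall i, g 0 i != 0) (eps0 : 0 < eps).
Let S := dotp x x + eps.
Let S0 : 0 < S. Proof. by rewrite ltr_wpDl ?dotp_ge0. Qed.
Let kap thi tho := kappa (metric_of R thi) (metric_of R tho) (RN g eps) x.

Let kap0 thi tho : x = 0 -> kap thi tho = 0%E.
Proof. by move=> xE; rewrite /kap xE kappa0 // RN0. Qed.

Lemma kappa_Two_Infty : kap Two Infty =
  ((\big[Num.max/0]_(i < d)
      (`|g 0 i| * Num.sqrt (1 - (1 + eps / S) * (x 0 i ^+ 2 / S))))%:E
   * ((enorm x)%:E / (snorm (hadamard g x))%:E))%E.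
Proof.
have [xE|x0] := eqVneq x 0.
  by rewrite kap0 // [in (enorm x)%:E]xE enorm0 mul0e mule0.
rewrite /kap kappa_RN_Infty // divEFin ?snorm_eq0 ?hadamard_eq0 // -EFinM.
congr (_%:E); rewrite mulrA; congr (_ / _).
rewrite mulrC -bigmaxZ ?enorm_ge0 //; apply: eq_bigr => i _.
by rewrite /dualnorm enorm_rnjac_delta // mulrCA.
Qed.

Lemma kappa_Infty_Infty : kap Infty Infty =
  ((\big[Num.max/0]_(i < d)
      (`|g 0 i| * (1 + `|x 0 i| * (norm1 x - 2 * `|x 0 i|) / S)))%:E
   * ((snorm x)%:E / (snorm (hadamard g x))%:E))%E.
Proof.
have [xE|x0] := eqVneq x 0.
  by rewrite kap0 // [in (snorm x)%:E]xE snorm0 mul0e mule0.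
rewrite /kap kappa_RN_Infty // divEFin ?snorm_eq0 ?hadamard_eq0 // -EFinM.
congr (_%:E); rewrite mulrA; congr (_ / _).
rewrite mulrC -bigmaxZ ?snorm_ge0 //; apply: eq_bigr => i _.
by rewrite dualnorm_Infty_delta // mulrCA.
Qed.

Lemma kappa_Comp_Infty : kap Comp Infty =
  ((2 * \big[Num.max/0]_(i < d)
      (`|g 0 i * x 0 i| * (1 - (x 0 i ^+ 2 + eps / 2) / S)))%:E
   * (1 / (snorm (hadamard g x))%:E))%E.
Proof.
have [xE|x0] := eqVneq x 0.
  (* Here the second factor is [1 / 0 = +oo]; the product vanishes because the maximum is 0. *)
  rewrite kap0 // (_ : \big[_/_]_i _ = 0) ?mulr0 ?mul0e //.
  by apply: bigmax_eq_id => i _; rewrite xE mxE mulr0 normr0 mul0r.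
rewrite /kap kappa_RN_Infty // divEFin ?snorm_eq0 ?hadamard_eq0 // -EFinM.
congr (_%:E); rewrite div1r; congr (_ / _).
rewrite -bigmaxZ //; apply: eq_bigr => i _.
by rewrite dualnorm_Comp_delta // normrM; ring.
Qed.

(** A componentwise input distance is excluded because it forbids moving the zero entry [i]. *)
Lemma kappa_Comp_pinfty thi i : thi <> Comp -> x != 0 -> x 0 i = 0 ->
  kap thi Comp = +oo%E.
Proof.
move=> thC x0 xi; apply: (@kappa_pinfty _ _ _ _ _ _ (delta_mx 0 i) i) => //.
- by case: thi thC.
- by rewrite RNE mxE hadamardE xi !mulr0.
move=> s s0; rewrite RNE mxE hadamardE !mxE xi !eqxx add0r mulr1.
rewrite !mulf_neq0 //; last by rewrite gt_eqF.
by rewrite invr_eq0 gt_eqF // sqrtr_gt0 ltr_wpDl ?dotp_ge0.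
Qed.

Lemma normNoo_eq0 i : x 0 i = 0 -> normNoo x = 0.
Proof.
have [j -> hj] := normNooP x d0 => xi.
by have := hj i; rewrite xi normr0 normr_le0 => /eqP ->; rewrite normr0.
Qed.

Lemma kappa_Infty_Comp : kap Infty Comp =
  ((1 / (normNoo x)%:E + ((norm1 x - 2 * normNoo x) / S)%:E)
   * (snorm x)%:E)%E.
Proof.
have [xE|x0] := eqVneq x 0.
  by rewrite kap0 // [in (snorm x)%:E]xE snorm0 mule0.
have [/forallP xi|] := boolP [forall i, x 0 i != 0]; last first.
  rewrite negb_forall => /existsP[i /negPn /eqP xi].
  rewrite (kappa_Comp_pinfty _ _ xi) // (normNoo_eq0 xi) inve0 mul1e.
  by rewrite addye // gt0_mulye // lte_fin snorm_gt0.
have nu0 : 0 < normNoo x by have [j -> _] := normNooP x d0; rewrite normr_gt0.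
rewrite /kap kappa_RN_Comp // divEFin ?gt_eqF // -EFinD -EFinM; congr (_%:E).
pose phi t := t^-1 * (snorm x * (1 + t * (norm1 x - 2 * t) / S)).
rewrite (_ : \big[_/_]_i _ = \big[Num.max/0]_i phi `|x 0 i|); last first.
  by apply: eq_bigr => i _; rewrite dualnorm_Infty_delta.
rewrite bigmax_normNoo //.
- by rewrite /phi; field; rewrite !gt_eqF.
- move=> i; rewrite /phi -(dualnorm_Infty_delta x i eps0).
  by rewrite mulr_ge0 ?invr_ge0 ?dualnorm_ge0.
(* In this form both terms visibly decrease in [t], so the smallest entry governs. *)
have phiE t : 0 < t -> phi t = snorm x * (t^-1 + (norm1 x - 2 * t) / S).
  by move=> t0; rewrite /phi; field; rewrite !gt_eqF.
move=> i j ij; rewrite !phiE ?normr_gt0 //.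
rewrite ler_wpM2l ?snorm_ge0 // lerD ?lef_pV2 ?posrE ?normr_gt0 //.
by rewrite ler_wpM2r ?invr_ge0 ?(ltW S0) // lerD2l lerN2 ler_wpM2l.
Qed.

Lemma kappa_Two_Comp : kap Two Comp =
  (sqrte (1 / (normNoo x ^+ 2)%:E - ((1 + eps / S) * (1 / S))%:E)
   * (enorm x)%:E)%E.
Proof.
have [xE|x0] := eqVneq x 0.
  by rewrite kap0 // [in (enorm x)%:E]xE enorm0 mule0.
have [/forallP xi|] := boolP [forall i, x 0 i != 0]; last first.
  rewrite negb_forall => /existsP[i /negPn /eqP xi].
  rewrite (kappa_Comp_pinfty _ _ xi) // (normNoo_eq0 xi) expr0n inve0 mul1e.
  by rewrite addye // gt0_mulye // lte_fin enorm_gt0.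
have nu0 : 0 < normNoo x by have [j -> _] := normNooP x d0; rewrite normr_gt0.
rewrite /kap kappa_RN_Comp // divEFin ?gt_eqF ?exprn_gt0 //.
rewrite -EFinB /sqrte -EFinM; congr (_%:E).
pose phi t := enorm x * Num.sqrt (1 / t ^+ 2 - (1 + eps / S) * (1 / S)).
rewrite (_ : \big[_/_]_i _ = \big[Num.max/0]_i phi `|x 0 i|); last first.
  apply: eq_bigr => i _; rewrite /dualnorm enorm_rnjac_delta // -/S mulrCA.
  congr (_ * _); have xi0 : 0 < `|x 0 i| by rewrite normr_gt0.
  rewrite -[X in X * _]ger0_norm ?invr_ge0 // -sqrtr_sqr -sqrtrM ?sqr_ge0 //.
  congr Num.sqrt; rewrite -(real_normK (num_real (x 0 i))).
  by field; rewrite !gt_eqF.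
rewrite bigmax_normNoo //.
- by rewrite /phi mulrC.
- by move=> i; rewrite mulr_ge0 ?enorm_ge0 ?sqrtr_ge0.
move=> i j ij; rewrite ler_wpM2l ?enorm_ge0 // ler_wsqrtr // lerD2r.
rewrite !div1r lef_pV2 ?posrE ?exprn_gt0 ?normr_gt0 //.
exact: lerXn2r.
Qed.

Lemma kappa_Comp_Comp : (forall i, x 0 i != 0) ->
  kap Comp Comp = (2 * (1 - (normNoo x ^+ 2 + eps / 2) / S))%:E.
Proof.
move=> xi; have x0 : x != 0.
  by apply/eqP => xE; have := xi (Ordinal d0); rewrite xE mxE eqxx.
rewrite /kap kappa_RN_Comp //; congr (_%:E).
pose phi t := 2 * (1 - (t ^+ 2 + eps / 2) / S).
have phiE i : `|x 0 i|^-1 * dualnorm Comp x (rnjac eps x (delta_mx 0 i))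
    = phi `|x 0 i|.
  rewrite dualnorm_Comp_delta // mulrA mulVf ?normr_eq0 // mul1r.
  by rewrite /phi real_normK ?num_real.
rewrite (eq_bigr _ (fun i _ => phiE i)) bigmax_normNoo //.
  by move=> i; rewrite -phiE mulr_ge0 ?invr_ge0 ?dualnorm_ge0.
move=> i j ij; rewrite ler_wpM2l // lerD2l lerN2.
rewrite ler_wpM2r ?invr_ge0 ?(ltW S0) // lerD2r.
exact: lerXn2r.
Qed.

Lemma kappa_Two_le thi K : x != 0 -> 0 <= K ->
  (forall h, supported thi x h -> enorm (rnjac eps x h) <= K * rnorm thi x h) ->
  (kap thi Two <= (K * (snorm g / enorm (hadamard g x)))%:E)%E.
Proof.
move=> x0 K0 hK; apply: kappa_RN_le => // [|h hs].
  by rewrite mulr_ge0 ?divr_ge0 ?snorm_ge0 ?enorm_ge0.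
rewrite rnorm_Two_L //.
rewrite [leRHS]mulrAC mulrA ler_wpM2r ?invr_ge0 ?enorm_ge0 //.
apply: le_trans (enorm_hadamard _ _) _.
by rewrite mulrC ler_wpM2r ?snorm_ge0 // hK.
Qed.

(** For constant [g] the only lossy step of [kappa_Two_le], bounding the product with [g], is an
    equality; a direction [h0] extremal for [J] then suffices. *)
Lemma kappa_Two_eq thi K c h0 : g = const_mx c -> x != 0 -> 0 <= K ->
  (forall h, supported thi x h -> enorm (rnjac eps x h) <= K * rnorm thi x h) ->
  supported thi x h0 -> 0 < rnorm thi x h0 ->
  K * rnorm thi x h0 <= enorm (rnjac eps x h0) ->
  kap thi Two = (K * (snorm g / enorm (hadamard g x)))%:E.
Proof.
move=> gE x0 K0 hK hs h_gt0 hh; apply/le_anti/andP; split.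
  exact: kappa_Two_le.
apply: (@kappa_RN_ge _ _ _ _ _ g0 eps0 x0 thi Two _ h0) => //.
rewrite rnorm_Two_L // {3}gE hadamard_const enormZ -(snorm_const c d0) -gE.
rewrite [leLHS]mulrAC mulrA ler_wpM2r ?invr_ge0 ?enorm_ge0 //.
by rewrite mulrC ler_wpM2l ?snorm_ge0.
Qed.

Let enorm_rnjac_Two h : x != 0 ->
  enorm (rnjac eps x h) <= enorm x * rnorm Two x h.
Proof.
by move=> x0; rewrite mulrC divfK ?enorm_eq0 // enorm_rnjac_le.
Qed.

Lemma kappa_Two_Two_le :
  (kap Two Two <= (snorm g * enorm x)%:E / (enorm (hadamard g x))%:E)%E.
Proof.
have [xE|x0] := eqVneq x 0.
  by rewrite kap0 // xE enorm0 mulr0 mul0e.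
rewrite divEFin ?enorm_eq0 ?hadamard_eq0 // (mulrC (snorm g)) -mulrA.
by apply: kappa_Two_le => // [|h _]; rewrite ?enorm_ge0 ?enorm_rnjac_Two.
Qed.

Lemma kappa_Two_Two_eq c : g = const_mx c -> (1 < d)%N \/ x = 0 ->
  kap Two Two = ((snorm g * enorm x)%:E / (enorm (hadamard g x))%:E)%E.
Proof.
have [xE _ _|x0 gE [d1|//]] := eqVneq x 0.
- by rewrite kap0 // xE enorm0 mulr0 mul0e.
- rewrite divEFin ?enorm_eq0 ?hadamard_eq0 // (mulrC (snorm g)) -mulrA.
  have [i xi] := rV_neq0 x0.
  have [j ji] : exists j, j != i.
    have [->|i0] := eqVneq i (Ordinal d0); first by exists (Ordinal d1).
    by exists (Ordinal d0); rewrite eq_sym.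
  (* A nonzero vector orthogonal to [x], hence fixed by [J]; it takes two distinct indices, whence
     [1 < d]. *)
  pose h0 : 'rV[R]_d := x 0 j *: delta_mx 0 i - x 0 i *: delta_mx 0 j.
  have xh : dotp x h0 = 0.
    by rewrite dotpBr !dotpZr !(dotpC x) !dotp_deltal mulrC subrr.
  have h_neq0 : h0 != 0.
    apply/eqP => /rowP/(_ j)/eqP.
    rewrite !mxE !eqxx (negPf ji) mulr0 mulr1 sub0r oppr_eq0; exact/negP.
  apply: (@kappa_Two_eq _ _ c h0) => //; rewrite ?enorm_ge0 //=.
  - by move=> h _; exact: enorm_rnjac_Two.
  - by rewrite divr_gt0 ?enorm_gt0.
  rewrite mulrC divfK ?enorm_eq0 //.
  by rewrite /rnjac xh mul0r scale0r subr0.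
by move=> xE; rewrite xE eqxx in x0.
Qed.

Let M (y : 'rV[R]_d) :=
  \big[Num.max/0]_s enorm (rnjac eps x (hadamard y (signs R s))).

Let M_attained y :
  exists s, M y = enorm (rnjac eps x (hadamard y (signs R s))).
Proof.
have [s _ hs] := eq_bigmax [ffun=> false] xpredT
  (fun s => enorm (rnjac eps x (hadamard y (signs R s)))) isT
  (fun s _ => enorm_ge0 _).
by exists s.
Qed.

Let hadamard1 (h : 'rV[R]_d) : hadamard (const_mx 1) h = h.
Proof. by rewrite hadamard_const scale1r. Qed.

Let enorm_rnjac_Infty h : x != 0 ->
  enorm (rnjac eps x h) <= M (const_mx 1) * snorm x * rnorm Infty x h.
Proof.
move=> x0; rewrite -mulrA (mulrC (snorm x)) divfK ?snorm_eq0 //.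
by rewrite -[in leLHS](hadamard1 h) enorm_rnjac_box.
Qed.

Let enorm_rnjac_Comp h : supported Comp x h ->
  enorm (rnjac eps x h) <= M x * rnorm Comp x h.
Proof.
by move=> hs; rewrite rnorm_Comp [in leLHS](supported_Comp hs) enorm_rnjac_box.
Qed.

Let MInftyE : \big[Num.max/0]_(s : {ffun 'I_d -> bool})
    Num.sqrt (d%:R - (1 + eps / S) * (dotp (signs R s) x ^+ 2 / S))
  = M (const_mx 1).
Proof.
apply: eq_bigr => s _; rewrite hadamard1 enorm_rnjac // (dotpC x).
congr (Num.sqrt (_ - _)); rewrite dotpE -[in LHS](card_ord d) -sumr_const.
apply: eq_bigr => i _.
by rewrite -expr2 -(real_normK (num_real _)) normr_signs expr1n.
Qed.

Let MCompE : \big[Num.max/0]_(s : {ffun 'I_d -> bool})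
    Num.sqrt (dotp x x
      - (1 + eps / S) * (dotp (signs R s) (hadamard x x) ^+ 2 / S))
  = M x.
Proof.
apply: eq_bigr => s _; rewrite enorm_rnjac //.
congr (Num.sqrt (_ - _ * (_ ^+ 2 / _))).
  rewrite !dotpE; apply: eq_bigr => i _.
  by rewrite hadamardE mulrACA -(expr2 (signs R s 0 i))
    -(real_normK (num_real (signs R s 0 i))) normr_signs expr1n mulr1.
by rewrite dotp_hadamard dotpC.
Qed.

Lemma kappa_Infty_Two_le : (kap Infty Two <=
  (\big[Num.max/0]_(s : {ffun 'I_d -> bool})
      Num.sqrt (d%:R - (1 + eps / S) * (dotp (signs R s) x ^+ 2 / S)))%:E
  * ((snorm g * snorm x)%:E / (enorm (hadamard g x))%:E))%E.
Proof.
rewrite MInftyE; have [xE|x0] := eqVneq x 0.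
  by rewrite kap0 // [in snorm x]xE snorm0 mulr0 mul0e mule0.
rewrite divEFin ?enorm_eq0 ?hadamard_eq0 // -EFinM.
rewrite (mulrC (snorm g)) -(mulrA (snorm x)) (mulrA _ (snorm x)).
apply: kappa_Two_le => // [|h _].
  by rewrite mulr_ge0 ?bigmax_ge_id ?snorm_ge0.
exact: enorm_rnjac_Infty.
Qed.

Lemma kappa_Infty_Two_eq c : g = const_mx c -> kap Infty Two =
  ((\big[Num.max/0]_(s : {ffun 'I_d -> bool})
      Num.sqrt (d%:R - (1 + eps / S) * (dotp (signs R s) x ^+ 2 / S)))%:E
  * ((snorm g * snorm x)%:E / (enorm (hadamard g x))%:E))%E.
Proof.
move=> gE; rewrite MInftyE; have [xE|x0] := eqVneq x 0.
  by rewrite kap0 // [in snorm x]xE snorm0 mulr0 mul0e mule0.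
rewrite divEFin ?enorm_eq0 ?hadamard_eq0 // -EFinM.
rewrite (mulrC (snorm g)) -(mulrA (snorm x)) (mulrA _ (snorm x)).
have [s hs] := M_attained (const_mx 1).
apply: (@kappa_Two_eq _ _ c (signs R s)) => //.
- by rewrite mulr_ge0 ?bigmax_ge_id ?snorm_ge0.
- by move=> h _; exact: enorm_rnjac_Infty.
- by rewrite /= snorm_signs // div1r invr_gt0 snorm_gt0.
by rewrite /= snorm_signs // div1r mulfK ?snorm_eq0 // hs hadamard1.
Qed.

Lemma kappa_Comp_Two_le : (kap Comp Two <=
  (\big[Num.max/0]_(s : {ffun 'I_d -> bool})
      Num.sqrt (dotp x x
        - (1 + eps / S) * (dotp (signs R s) (hadamard x x) ^+ 2 / S)))%:E
  * ((snorm g)%:E / (enorm (hadamard g x))%:E))%E.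
Proof.
rewrite MCompE; have [xE|x0] := eqVneq x 0.
  (* At [x = 0] the left side is 0, so nonnegativity of the bound is enough. *)
  rewrite kap0 // mule_ge0 ?lee_fin ?bigmax_ge_id //.
  by rewrite mule_ge0 ?inve_ge0 ?lee_fin ?snorm_ge0 ?enorm_ge0.
rewrite divEFin ?enorm_eq0 ?hadamard_eq0 // -EFinM.
apply: kappa_Two_le x0 (bigmax_ge_id _ _ _ _) _.
exact: enorm_rnjac_Comp.
Qed.

Lemma kappa_Comp_Two_eq c : g = const_mx c -> kap Comp Two =
  ((\big[Num.max/0]_(s : {ffun 'I_d -> bool})
      Num.sqrt (dotp x x
        - (1 + eps / S) * (dotp (signs R s) (hadamard x x) ^+ 2 / S)))%:E
  * ((snorm g)%:E / (enorm (hadamard g x))%:E))%E.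
Proof.
move=> gE; rewrite MCompE; have [s hs] := M_attained x.
have [xE|x0] := eqVneq x 0.
  (* Equality needs more than the inequality: [snorm g / 0] is [+oo], so the maximum itself must be
     shown to vanish. *)
  have -> : M x = 0.
    rewrite hs (_ : hadamard x _ = 0).
      by rewrite /rnjac xE scaler0 subr0 enorm0.
    by apply/rowP => i; rewrite hadamardE xE !mxE mul0r.
  by rewrite kap0 // mul0e.
rewrite divEFin ?enorm_eq0 ?hadamard_eq0 // -EFinM.
apply: (@kappa_Two_eq _ _ c (hadamard x (signs R s))) => //.
- exact: bigmax_ge_id.
- exact: supported_hadamard.
- by rewrite rnorm_Comp_signs.
by rewrite rnorm_Comp_signs // mulr1 hs.
Qed.
End RN_condition_numbers.

(* All the maxima below are of nonnegative quantities, hence the default 0. *)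
Theorem theorem3p1 (R : realType) (d : nat) (g : 'rV[R]_d) (eps : R)
    (x : 'rV[R]_d) :
  (0 < d)%N -> (forall i, g 0 i != 0) -> 0 < eps ->
  let S : R := norm2 x ^+ 2 + eps in
  let gx : 'rV[R]_d := hadamard g x in
  let f : 'rV[R]_d -> 'rV[R]_d := RN g eps in
  let two : metric R := Lp 2%:E in
  let oo : metric R := Lp +oo%E in
  let c : metric R := Componentwise in
  let B22 : \bar R := ((normoo g * norm2 x)%:E / (norm2 gx)%:E)%E in
  let Boo2 : \bar R :=
    ((\big[Num.max/0]_(s : {ffun 'I_d -> bool})
        Num.sqrt (d%:R - (1 + eps / S) * (dotp (signs R s) x ^+ 2 / S)))%:E
     * ((normoo g * normoo x)%:E / (norm2 gx)%:E))%E in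
  let Bc2 : \bar R :=
    ((\big[Num.max/0]_(s : {ffun 'I_d -> bool})
        Num.sqrt (norm2 x ^+ 2
          - (1 + eps / S) * (dotp (signs R s) (hadamard x x) ^+ 2 / S)))%:E
     * ((normoo g)%:E / (norm2 gx)%:E))%E in
  (* normwise *)
  (kappa two two f x <= B22)%E /\
  kappa two oo f x =
    ((\big[Num.max/0]_(i < d)
        (`|g 0 i| * Num.sqrt (1 - (1 + eps / S) * (x 0 i ^+ 2 / S))))%:E
     * ((norm2 x)%:E / (normoo gx)%:E))%E /\
  (kappa oo two f x <= Boo2)%E /\
  kappa oo oo f x =
    ((\big[Num.max/0]_(i < d)
        (`|g 0 i| * (1 + `|x 0 i| * (norm1 x - 2 * `|x 0 i|) / S)))%:E
     * ((normoo x)%:E / (normoo gx)%:E))%E /\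
  (* mixed *)
  kappa c oo f x =
    ((2 * \big[Num.max/0]_(i < d)
        (`|g 0 i * x 0 i| * (1 - (x 0 i ^+ 2 + eps / 2) / S)))%:E
     * (1 / (normoo gx)%:E))%E /\
  kappa oo c f x =
    ((1 / (normNoo x)%:E + ((norm1 x - 2 * normNoo x) / S)%:E)
     * (normoo x)%:E)%E /\
  (kappa c two f x <= Bc2)%E /\
  kappa two c f x =
    (sqrte (1 / (normNoo x ^+ 2)%:E - ((1 + eps / S) * (1 / S))%:E)
     * (norm2 x)%:E)%E /\
  (* componentwise; the formula fails as soon as some x_i vanishes *)
  ((forall i, x 0 i != 0) ->
   kappa c c f x = (2 * (1 - (normNoo x ^+ 2 + eps / 2) / S))%:E) /\
  (* equality cases; for d = 1 and x != 0 the first one fails *)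
  (forall a : R, g = const_mx a ->
     ((1 < d)%N \/ x = 0 -> kappa two two f x = B22) /\
     kappa oo two f x = Boo2 /\
     kappa c two f x = Bc2).

Proof.
move=> d0 g0 eps0; rewrite norm2E normooE enorm_sqr.
move=> S gx f two oo c B22 Boo2 Bc2.
split; first exact: kappa_Two_Two_le.
split; first exact: kappa_Two_Infty.
split; first exact: kappa_Infty_Two_le.
split; first exact: kappa_Infty_Infty.
split; first exact: kappa_Comp_Infty.
split; first exact: kappa_Infty_Comp.
split; first exact: kappa_Comp_Two_le.
split; first exact: kappa_Two_Comp.
split; first exact: kappa_Comp_Comp.
move=> a gE; split; first exact: kappa_Two_Two_eq gE.
split; first exact: kappa_Infty_Two_eq gE.
exact: kappa_Comp_Two_eq gE.
Qed.
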